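(* Consider the linear model $y_i=\langle\boldsymbol{x}_i,\boldsymbol{\theta}^*\rangle+\varepsilon_i$, $i=1,\dots,n$, with i.i.d. data $(y_i,\boldsymbol{x}_i)\in\mathbb{R}\times\mathbb{R}^d$, $\boldsymbol{\theta}^*\in\mathbb{R}^d$, and i.i.d. noise satisfying $\mathbb{E}[\varepsilon_i|\boldsymbol{x}_i]=0$, $\mathbb{E}[\varepsilon_i^2|\boldsymbol{x}_i]=\sigma^2$, $m_{2\beta}=\mathbb{E}[|\varepsilon_i|^{2\beta}|\boldsymbol{x}_i]<\infty$ for some $\beta\in(1,2]$. Let $L=\max_{1\le i\le n}\|\boldsymbol{x}_i\|_2<\infty$ and suppose that the empirical Gram matrix $\mathbf{S}_n=\frac1n\sum_{i=1}^n\boldsymbol{x}_i\boldsymbol{x}_i^T$ is nonsingular with $c_l\le\lambda_{\min}(\mathbf{S}_n)\le\lambda_{\max}(\mathbf{S}_n)\le c_u$ for constants $c_l,c_u>0$. Let $\epsilon\in(0,1/6)$, and let $\psi_1,\psi_2$, $\alpha_1,\alpha_2$, the penalty coefficient $\lambda_0$, and $\tilde f_1^{ridge},\tilde f_2^{ridge}$ be as in the context, with $\psi_1$ satisfying the regularity assumption there with constant $M$. There exists a constant $C=C(m_{2\beta},\sigma,\beta,c_u,L,M)$ such that, as long as $$n\ge Cd(c_l+\lambda_0)^{-1}[\log(\epsilon^{-1})+1],$$ with probability at least $1-6\epsilon$, the system $\tilde f_1^{ridge}(\boldsymbol{\theta},v)=\boldsymbol{0}$, $\tilde f_2^{ridge}(\boldsymbol{\theta},v)=0$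 admits a solution $(\hat{\boldsymbol{\theta}},\hat v)$ which satisfies $$\|\boldsymbol{\theta}^*-\hat{\boldsymbol{\theta}}\|_2\le\theta_0$$ and $$\left(1+C_2\left(\alpha_2^{\beta-1}+\frac{\theta_0}{\theta_0+\frac12}\right)\right)^{-\frac12}\sigma\le\hat v\le\left(1-C_2\left(\alpha_2^{\beta-1}+\frac{\theta_0}{\theta_0+\frac12}\right)\right)^{-\frac12}\sigma,$$ with $C_1=C_1(c_l,L)$, $C_2=C_2(m_{2\beta},\sigma,\beta,c_u,L)$ and $$\theta_0=C_1\left(\frac{\sqrt d\,L}{\lambda_0+c_l/\sigma}\sqrt{\frac{\log(d\epsilon^{-1})}{n}}+\frac{\lambda_0}{\lambda_0+c_l/\sigma}\|\boldsymbol{\theta}^*\|_2\right).$$ In particular, if $c_l>0$, then taking $\lambda_0=O\left(L\sqrt{\frac{d\log(d\epsilon^{-1})}{n}}\right)$ gives $$\|\boldsymbol{\theta}^*-\hat{\boldsymbol{\theta}}\|_2\le O\left(L\sqrt{\frac{d\log(d\epsilon^{-1})}{n}}\right).$$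
   Context: $\psi_1,\psi_2:\mathbb{R}\to\mathbb{R}$ are continuous non-decreasing functions, each with a root at $0$, satisfying for all $x\in\mathbb{R}$ $$-\log\left(1-x+\tfrac{|x|^2}{2}\right)\le\psi_1(x)\le\log\left(1+x+\tfrac{|x|^2}{2}\right),\qquad -\log\left(1-x+\tfrac{|x|^\beta}{\beta}\right)\le\psi_2(x)\le\log\left(1+x+\tfrac{|x|^\beta}{\beta}\right).$$ Regularity assumption on $\psi_1$: $\psi_1$ is twice differentiable except at finitely many points, and $|\psi_1''(x)|\le M\min\{1,1/x^2\}$ wherever it exists, for some positive constant $M$. Parameters: $\alpha_1=\sqrt{2\log(d\epsilon^{-1})/n}$, $\alpha_2=\left(\log(\epsilon^{-1})/n\right)^{1/\beta}$, and $\lambda=\lambda_0\alpha_1$, where $\lambda_0$ is the (positive) penalty coefficient. For $\boldsymbol{\theta}\in\mathbb{R}^d$, $v>0$, $$\tilde f_1^{ridge}(\boldsymbol{\theta},v)=\frac1n\sum_{i=1}^n\boldsymbol{x}_i\psi_1\left(\alpha_1\frac{y_i-\langle\boldsymbol{x}_i,\boldsymbol{\theta}\rangle}{v}\right)-\lambda\boldsymbol{\theta},\qquad \tilde f_2^{ridge}(\boldsymbol{\theta},v)=\frac1n\sum_{i=1}^n\psi_2\left(\alpha_2\left(\frac{(y_i-\langle\boldsymbol{x}_i,\boldsymbol{\theta}\rangle)^2}{v^2}-1\right)\right).$$ The eigenvalue condition on $\mathbf{S}_n$ and the bound $L$ are deterministic assumptions on the covariates. Here $\lambda_{\min},\lambda_{\max}$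 denote the minimal and maximal eigenvalues. The notation $C(\cdot)$ denotes a positive constant depending only on the listed arguments.
   Formalization: The whole conclusion is proved under the added condition 1 − C_2(α_2^{β−1} + θ_0/(θ_0+1/2)) > 0, without which the upper bound for v̂ is undefined and the existence claim can fail (e.g. d=1, x_i=1, noise ±1, θ* = 2/λ_0, λ_0 small, n large). *)

(* Defs.v *)
From HB Require Import structures.
From mathcomp Require Import all_boot all_order all_algebra.
From mathcomp Require Import all_classical all_reals all_analysis.

Set Implicit Arguments.
Unset Strict Implicit.
Unset Printing Implicit Defensive.

Import Order.TTheory GRing.Theory Num.Theory.
Import numFieldNormedType.Exports.

Local Open Scope classical_set_scope.
Local Open Scope ring_scope.

Definition borel (V : topologicalType) : set (set V) := <<s [set U : set V | open U] >>.
Arguments borel : clear implicits.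

Definition sigma_of {T : Type} {V : topologicalType} (X : T -> V) : set (set T) :=
  preimage_set_system setT X (borel V).

Definition sigma_family {I T : Type} {V : topologicalType} (X : I -> T -> V) : set (set T) :=
  <<s \bigcup_i sigma_of (X i) >>.

Definition borel_measurable {disp : measure_display} {T : measurableType disp}
    {V : topologicalType} (X : T -> V) : Prop :=
  forall B : set V, borel V B -> measurable (X @^-1` B).

Section Probability.
Context {R : realType} {disp : measure_display} {T : measurableType disp}.
Variable P : probability T R.

Definition mutually_independent {I : finType} {V : topologicalType} (X : I -> T -> V) : Prop :=
  forall (J : {set I}) (B : I -> set V), (forall i, borel V (B i)) ->
    P (\bigcap_(i in [set` J]) (X i @^-1` B i)) =
    (\prod_(i in J) P (X i @^-1` B i))%E.

Definition identically_distributed {I : Type} {V : topologicalType} (X : I -> T -> V) : Prop :=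
  forall (i j : I) (B : set V), borel V B -> P (X i @^-1` B) = P (X j @^-1` B).

Definition iid {I : finType} {V : topologicalType} (X : I -> T -> V) : Prop :=
  [/\ forall i, borel_measurable (X i),
      mutually_independent X
    & identically_distributed X].

(* [g] is a version of E[Z | X] *)
Definition is_cond_exp {V : topologicalType} (X : T -> V) (Z g : T -> R) : Prop :=
  [/\ P.-integrable setT (EFin \o Z),
      P.-integrable setT (EFin \o g),
      (forall B : set R, borel R B -> sigma_of X (g @^-1` B))
    & (forall A : set T, sigma_of X A ->
         (\int[P]_(w in A) (Z w)%:E = \int[P]_(w in A) (g w)%:E)%E)].

(* On the event [G], the conditional probability of [E] given the sigma-algebra
   [F] is at least [p]. If [G] has full measure and belongs to [F], this
   contains the unconditional bound p <= P E. *)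
Definition cond_prob_ge (F : set (set T)) (G E : set T) (p : R) : Prop :=
  forall A : set T, F A -> A `<=` G -> (p%:E * P A <= P (A `&` E))%E.

End Probability.

Section Euclidean.
Context {R : realType} {d : nat}.

Definition dotp (x y : 'cV[R]_d) : R := \sum_(j < d) x j 0 * y j 0.

(* The library norm on matrices is the sup norm. *)
Definition norm2 (x : 'cV[R]_d) : R := Num.sqrt (dotp x x).

Definition gram {n : nat} (x : 'I_n -> 'cV[R]_d) : 'M[R]_d :=
  n%:R^-1 *: \sum_(i < n) x i *m (x i)^T.

(* The spectrum is finite, and nonempty for symmetric [S] with d > 0, so that
   inf and sup are then a minimum and a maximum. *)
Definition lambda_min (S : 'M[R]_d) : R := inf [set a : R | eigenvalue S a].
Definition lambda_max (S : 'M[R]_d) : R := sup [set a : R | eigenvalue S a].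

Definition design_condition (c_l c_u L : R) {n : nat} (x : 'I_n -> 'cV[R]_d) : Prop :=
  [/\ \big[Num.max/0]_(i < n) norm2 (x i) <= L,
      gram x \in unitmx,
      c_l <= lambda_min (gram x),
      lambda_min (gram x) <= lambda_max (gram x)
    & lambda_max (gram x) <= c_u].

End Euclidean.

Section Influence.
Context {R : realType}.

Definition influence_function (b : R) (psi : R -> R) : Prop :=
  [/\ continuous psi,
      {homo psi : s t / s <= t},
      psi 0 = 0
    & forall x : R,
        - ln (1 - x + `|x| `^ b / b) <= psi x /\
        psi x <= ln (1 + x + `|x| `^ b / b)].

Definition twice_derivable (f : R -> R) (x : R) : Prop :=
  (\forall t \near x, derivable f t 1) /\ derivable (derive1 f) x 1.

(* min {1, 1/x^2}, with value 1 at 0 (where the library's inverse is 0) *)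
Definition capped_inv_sq (x : R) : R :=
  if x == 0 then 1 else Num.min 1 (1 / x ^+ 2).

Definition regular_influence (M : R) (psi : R -> R) : Prop :=
  (exists s : seq R, forall x : R, x \notin s -> twice_derivable psi x) /\
  (forall x : R, twice_derivable psi x -> `|derive1n 2 psi x| <= M * capped_inv_sq x).

End Influence.

Section Estimator.
Context {R : realType}.

Definition alpha1 (d n : nat) (eps : R) : R :=
  Num.sqrt (2 * ln (d%:R * eps^-1) / n%:R).

Definition alpha2 (n : nat) (beta eps : R) : R :=
  (ln (eps^-1) / n%:R) `^ (1 / beta).

Definition f1_ridge (psi1 : R -> R) (a1 lam0 : R) {n d : nat}
    (x : 'I_n -> 'cV[R]_d) (y : 'I_n -> R) (theta : 'cV[R]_d) (v : R) : 'cV[R]_d :=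
  n%:R^-1 *: (\sum_(i < n) psi1 (a1 * ((y i - dotp (x i) theta) / v)) *: x i)
  - (lam0 * a1) *: theta.

Definition f2_ridge (psi2 : R -> R) (a2 : R) {n d : nat}
    (x : 'I_n -> 'cV[R]_d) (y : 'I_n -> R) (theta : 'cV[R]_d) (v : R) : R :=
  n%:R^-1 *
  \sum_(i < n) psi2 (a2 * ((y i - dotp (x i) theta) ^+ 2 / v ^+ 2 - 1)).

Definition theta0 (C1 : R) (d n : nat) (eps sigma c_l L lam0 : R)
    (thetastar : 'cV[R]_d) : R :=
  C1 * (Num.sqrt d%:R * L / (lam0 + c_l / sigma) * Num.sqrt (ln (d%:R * eps^-1) / n%:R)
        + lam0 / (lam0 + c_l / sigma) * norm2 thetastar).

Definition scale_error (C2 a2 beta t0 : R) : R :=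
  C2 * (a2 `^ (beta - 1) + t0 / (t0 + 1 / 2)).

Definition ridge_rate (d n : nat) (eps L : R) : R :=
  L * Num.sqrt (d%:R * ln (d%:R * eps^-1) / n%:R).

End Estimator.

(* Main.v *)
Require Import Defs.
From HB Require Import structures.
From mathcomp Require Import all_boot all_order all_algebra.
From mathcomp Require Import all_classical all_reals all_analysis.
From mathcomp Require Import measurable_realfun.
From mathcomp Require Import ring lra.

Set Implicit Arguments.
Unset Strict Implicit.
Unset Printing Implicit Defensive.

Import Order.TTheory GRing.Theory Num.Theory.
Import numFieldNormedType.Exports.

Local Open Scope classical_set_scope.
Local Open Scope ring_scope.

(** Write [s_i = a1 * noise_i / sigma]. The theorem splits into a deterministic
    statement about samples on which four kinds of sums are controlled, and tail
    bounds for these sums that hold conditionally on the design.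

    Deterministic part. For a fixed scale [v] the regression equation is the
    stationarity condition of a strongly convex function of [theta], since [psi1]
    is non-decreasing and the ridge penalty is positive. So it has exactly one
    zero ([ridge_field_zero], [ridge_field_strongly_monotone]), which depends continuously on the inverse scale
    ([ridge_zero_path]), and it lies in a ball as soon as the field points outwards
    on the sphere ([ridge_zero_in_ball]). Substituting this zero into the scale
    equation leaves one continuous real function, whose root is given by the
    intermediate value theorem ([ridge_system_solution]).

    The sphere of radius [t0] is handled with two consequences of the logarithmic
    envelope of [psi1]: [psi1 u] differs from [u] by at most [u^2 / 2], and
    [psi1 (r * u) - r * psi1 u] is at most [5 * ln (1 + u^2)]. The second one makes a
    single event, the one for the scale [sigma], sufficient for all scales near
    [sigma]. If [lam0 >= c_l / sigma] the penalty alone dominates the noise.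
    Otherwise curvature comes from the indices with [|s_i| <= 1], where the
    quadratic error bound keeps half of the linear decrease
    ([mul_influence_curvature_le]), while the other indices cost at most
    [L^2] times their proportion, which the sum of the [ln (1 + s_i^2)] bounds.
    In the scale equation the residual is compared with the noise by
    [(1 - t0) e^2 - t0 L^2 <= (e - a)^2 <= (1 + t0) e^2 + 2 t0 L^2], uniformly over
    the ball, so that by monotonicity of [psi2] two sums in the noise alone decide
    its sign at the two end points.

    Probabilistic part. Each sum is bounded above by the exponential Markov
    inequality with a weight [wt] that dominates the exponential of the summand and
    is a combination of the noise, its square and its absolute moment of order
    [2 * beta], chosen so that its conditional mean given the covariate is a
    constant [c]. For such weights the integral of their product over a design
    event [A] is exactly [c ^ n * P A] ([cond_expectation_prod]): independence gives
    it on rectangles, and the pi-lambda theorem on the whole sigma-algebra. This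
    yields the conditional tail bounds [score_tail], [log_tail] and [scale_tail],
    whose failure probabilities add up to five times [eps].

    The hypothesis [0 < 1 - e2] makes [t0] and [alpha2] small compared with the
    constants chosen below, and through [t0] also [alpha1] when the penalty does
    not dominate. *)

(** * Influence functions *)

Section Scalars.
Context {R : realType}.
Implicit Types (b x s r u p t : R) (psi : R -> R).

(** Young's inequality with second factor 1. *)
Lemma powR_tangent b t : 1 < b -> 0 <= t -> 1 + b * (t - 1) <= t `^ b.
Proof.
move=> b1 t0; have b0 : 0 < b by rewrite (lt_trans _ b1).
have bm0 : 0 < b - 1 by rewrite subr_gt0.
have q0 : 0 < b / (b - 1) by rewrite divr_gt0.
have pq : b^-1 + (b / (b - 1))^-1 = 1.
  by rewrite invf_div; field; rewrite !gt_eqF.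
have := conjugate_powR t0 ler01 b0 q0 pq; rewrite powR1 mul1r mulr1 invf_div.
rewrite -mulrDl ler_pdivlMr// => h; lra.
Qed.

(** The logarithms in the envelope have positive arguments, so the envelope can
    be exponentiated; this is Bernoulli's inequality at [`|x|]. *)
Lemma influence_arg_gt0 b x : 1 < b -> 0 < 1 + x + `|x| `^ b / b.
Proof.
move=> b1; have b0 : 0 < b by rewrite (lt_trans _ b1).
have h := powR_tangent b1 (normr_ge0 x).
have : b^-1 + (`|x| - 1) <= `|x| `^ b / b.
  by rewrite ler_pdivlMr// mulrDl mulVf ?gt_eqF// [_ * b]mulrC.
have := ler_norm (- x); rewrite normrN.
have : 0 < b^-1 by rewrite invr_gt0.
lra.
Qed.

Lemma influence_expR_le b psi x : 1 < b -> influence_function b psi ->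
  expR (psi x) <= 1 + x + `|x| `^ b / b.
Proof.
move=> b1 [_ _ _ /(_ x)[_ h]].
by rewrite -[leRHS]lnK ?ler_expR// posrE influence_arg_gt0.
Qed.

Lemma influence_expRN_le b psi x : 1 < b -> influence_function b psi ->
  expR (- psi x) <= 1 - x + `|x| `^ b / b.
Proof.
move=> b1 [_ _ _ /(_ x)[h _]].
have := influence_arg_gt0 (- x) b1; rewrite normrN => h0.
by rewrite -[leRHS]lnK ?ler_expR ?posrE// lerNl.
Qed.

Lemma powR_norm2 x : `|x| `^ 2 = x ^+ 2.
Proof. by rewrite powR_mulrn// real_normK// num_real. Qed.

Lemma expR_convex_comb u p : 0 <= u <= 1 -> expR (u * p) <= 1 - u + u * expR p.
Proof.
move=> u01; have [u0 u1] := andP u01.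
have := @convex_expR R (Itv01 u0 u1) p 0.
by rewrite !convRE /=; rewrite mulr0 addr0 expR0 mulr1 addrC.
Qed.

(** A factor [u] in [-1, 1] passes through the exponential by convexity, as a
    proportion in which 1 and the exponential envelope are mixed. *)
Lemma influence2_expRM_le psi u x : influence_function 2 psi -> `|u| <= 1 ->
  expR (u * psi x) <= 1 + u * x + x ^+ 2 / 2.
Proof.
move=> hpsi; rewrite ler_norml => /andP[u1 u2].
have h2 : 1 < 2 :> R by lra.
have x2 := sqr_ge0 x.
have [u0|u0] := leP 0 u.
  apply: (le_trans (expR_convex_comb _ _)); first by rewrite u0 u2.
  have := influence_expR_le x h2 hpsi; rewrite powR_norm2 => h.
  nra.
rewrite -mulrNN.
apply: (le_trans (expR_convex_comb _ _)); first by apply/andP; split; lra.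
have := influence_expRN_le x h2 hpsi; rewrite powR_norm2 => h.
nra.
Qed.

(** From [ln (1 + t) <= t] on both sides of the envelope. *)
Lemma influence2_sub_le psi x : influence_function 2 psi ->
  `|psi x - x| <= x ^+ 2 / 2.
Proof.
move=> [_ _ _ /(_ x)]; rewrite powR_norm2 => -[h1 h2].
have h : 1 < 2 :> R by lra.
have h3 : ln (1 + x + x ^+ 2 / 2) <= x + x ^+ 2 / 2.
  rewrite -addrA; apply: le_ln1Dx.
  by have := influence_arg_gt0 x h; rewrite powR_norm2; lra.
have h4 : ln (1 - x + x ^+ 2 / 2) <= - x + x ^+ 2 / 2.
  rewrite -addrA; apply: le_ln1Dx.
  by have := influence_arg_gt0 (- x) h; rewrite normrN powR_norm2; lra.
by rewrite ler_norml; apply/andP; split; lra.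
Qed.

Lemma influence2_norm_le psi x : influence_function 2 psi ->
  `|psi x| <= ln (1 + `|x| + x ^+ 2 / 2).
Proof.
move=> [_ hm h0 /(_ x)]; rewrite powR_norm2 => -[h1 h2].
have [x0|/ltW x0] := leP 0 x.
  by have := hm _ _ x0; rewrite h0 => p0; rewrite (ger0_norm x0) (ger0_norm p0).
by have := hm _ _ x0; rewrite h0 => p0; rewrite (ler0_norm x0) (ler0_norm p0) lerNl.
Qed.

Lemma ln1D_ge x : 0 <= x -> x / (1 + x) <= ln (1 + x).
Proof.
move=> x0; have x1 : 0 < 1 + x by lra.
rewrite -[ln _]opprK -lnV ?posrE// lerNr.
rewrite (_ : ln _ = ln (1 - x / (1 + x))); last by congr ln; field; rewrite gt_eqF.
by apply: le_ln1Dx; rewrite ltrN2 ltr_pdivrMr//; lra.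
Qed.

Lemma half_le_ln1D x : 0 <= x <= 1 -> x / 2 <= ln (1 + x).
Proof.
move=> /andP[x0 x1]; apply: le_trans (ln1D_ge x0).
rewrite ler_pdivlMr; last lra.
nra.
Qed.

Lemma ln1D_ge_half x : 1 <= x -> 1 / 2 <= ln (1 + x).
Proof.
move=> x1; have x0 : 0 <= x by lra.
apply: le_trans (ln1D_ge x0); rewrite ler_pdivlMr; lra.
Qed.

(** For small [s] both sides are linear up to quadratic errors; for large [s]
    both grow logarithmically. The bound is a logarithm because its exponential
    has a finite mean under a second moment. *)
Lemma influence2_scale_le psi r s : influence_function 2 psi ->
  0 < r -> r ^+ 2 <= 3 / 2 ->
  `|psi (r * s) - r * psi s| <= 5 * ln (1 + s ^+ 2).
Proof.
move=> hpsi r0 r2; have r1 : r <= 5 / 4 by nra.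
have s2 := sqr_ge0 s.
have [s1|s1] := leP (s ^+ 2) 1.
  have h1 := influence2_sub_le (r * s) hpsi.
  have h2 := influence2_sub_le s hpsi.
  have h3 : s ^+ 2 / 2 <= ln (1 + s ^+ 2) by apply: half_le_ln1D; rewrite s2.
  have -> : psi (r * s) - r * psi s =
      (psi (r * s) - r * s) - r * (psi s - s) by ring.
  apply: (le_trans (ler_normB _ _)); rewrite normrM (gtr0_norm r0).
  rewrite exprMn in h1.
  have : r * `|psi s - s| <= 5 / 4 * (s ^+ 2 / 2).
    by apply: ler_pM => //; lra.
  have : r ^+ 2 * s ^+ 2 <= 3 / 2 * s ^+ 2 by apply: ler_wpM2r.
  lra.
have h (x : R) : x ^+ 2 <= 3 / 2 * s ^+ 2 -> `|psi x| <= 2 * ln (1 + s ^+ 2).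
  move=> xs; apply: (le_trans (influence2_norm_le x hpsi)).
  have -> : 2 * ln (1 + s ^+ 2) = ln ((1 + s ^+ 2) ^+ 2).
    by rewrite lnXn ?mulr_natl//; lra.
  rewrite ler_ln ?posrE.
  - have := sqr_ge0 (`|x| - 1).
    have -> : (`|x| - 1) ^+ 2 = x ^+ 2 - 2 * `|x| + 1.
      by rewrite -[x ^+ 2]real_normK ?num_real//; ring.
    nra.
  - by have := sqr_ge0 x; have := normr_ge0 x; lra.
  - by rewrite exprn_gt0//; lra.
apply: (le_trans (ler_normB _ _)); rewrite normrM (gtr0_norm r0).
have h1 : `|psi (r * s)| <= 2 * ln (1 + s ^+ 2).
  by apply: h; rewrite exprMn; apply: ler_wpM2r.
have h2 : `|psi s| <= 2 * ln (1 + s ^+ 2) by apply: h; lra.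
have : r * `|psi s| <= 5 / 4 * (2 * ln (1 + s ^+ 2)) by apply: ler_pM => //; lra.
have : 0 <= ln (1 + s ^+ 2) by apply: ln_ge0; lra.
lra.
Qed.

End Scalars.

Lemma continuous_mulr (R : realType) (T : topologicalType) (f g : T -> R) :
  continuous f -> continuous g -> continuous (fun t => f t * g t).
Proof. by move=> cf cg t; apply: cvgM; [exact: cf|exact: cg]. Qed.

Lemma continuous_addr (R : realType) (T : topologicalType) (f g : T -> R) :
  continuous f -> continuous g -> continuous (fun t => f t + g t).
Proof. by move=> cf cg t; apply: cvgD; [exact: cf|exact: cg]. Qed.

Lemma continuous_subr (R : realType) (T : topologicalType) (f g : T -> R) :
  continuous f -> continuous g -> continuous (fun t => f t - g t).
Proof. by move=> cf cg t; apply: cvgB; [exact: cf|exact: cg]. Qed.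

Lemma continuous_cst (R : realType) (T : topologicalType) (a : R) :
  continuous (fun _ : T => a).
Proof. by move=> t; exact: cvg_cst. Qed.

Lemma continuous_sumr (R : realType) (T : topologicalType) n (F : 'I_n -> T -> R) :
  (forall i, continuous (F i)) -> continuous (fun t => \sum_(i < n) F i t).
Proof.
by move=> cF; apply: continuous_big => [|i _]; [exact: add_continuous|exact: cF].
Qed.

(** * Euclidean vectors and the Gram form *)

Section Euclid.
Context {R : realType} {d : nat}.
Implicit Types (x y z u w : 'cV[R]_d) (a : R).

Lemma dotpC x y : dotp x y = dotp y x.
Proof. by apply: eq_bigr => j _; rewrite mulrC. Qed.

Lemma dotpDr x y z : dotp x (y + z) = dotp x y + dotp x z.
Proof. by rewrite -big_split; apply: eq_bigr => j _; rewrite mxE mulrDr. Qed.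

Lemma dotpZr a x y : dotp x (a *: y) = a * dotp x y.
Proof. by rewrite /dotp mulr_sumr; apply: eq_bigr => j _; rewrite mxE mulrCA. Qed.

Lemma dotpNr x y : dotp x (- y) = - dotp x y.
Proof. by rewrite -scaleN1r dotpZr mulN1r. Qed.

Lemma dotpBr x y z : dotp x (y - z) = dotp x y - dotp x z.
Proof. by rewrite dotpDr dotpNr. Qed.

Lemma dotpDl x y z : dotp (x + y) z = dotp x z + dotp y z.
Proof. by rewrite dotpC dotpDr !(dotpC z). Qed.

Lemma dotpZl a x y : dotp (a *: x) y = a * dotp x y.
Proof. by rewrite dotpC dotpZr dotpC. Qed.

Lemma dotpNl x y : dotp (- x) y = - dotp x y.
Proof. by rewrite dotpC dotpNr dotpC. Qed.

Lemma dotpBl x y z : dotp (x - y) z = dotp x z - dotp y z.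
Proof. by rewrite dotpDl dotpNl. Qed.

Lemma dotp0r x : dotp x 0 = 0.
Proof. by rewrite -(scale0r 0) dotpZr mul0r. Qed.

Lemma dotp_suml I (r : seq I) (F : I -> 'cV[R]_d) u :
  dotp (\sum_(i <- r) F i) u = \sum_(i <- r) dotp (F i) u.
Proof.
elim/big_rec2 : _ => [|i a x _ <-]; first by rewrite dotpC dotp0r.
by rewrite dotpDl.
Qed.

Lemma dotp_ge0 x : 0 <= dotp x x.
Proof. by apply: sumr_ge0 => j _; rewrite -expr2 sqr_ge0. Qed.

Lemma dotp_eq0 x : dotp x x = 0 -> x = 0.
Proof.
move=> /eqP; rewrite psumr_eq0 => [|j _]; last by rewrite -expr2 sqr_ge0.
move=> /allP h; apply/matrixP => j k; rewrite (ord1 k) mxE.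
have := h j (mem_index_enum _); rewrite /= mulf_eq0 orbb.
by move/eqP.
Qed.

Lemma norm2_ge0 x : 0 <= norm2 x. Proof. exact: sqrtr_ge0. Qed.

Lemma norm2_sqr x : norm2 x ^+ 2 = dotp x x.
Proof. by rewrite sqr_sqrtr// dotp_ge0. Qed.

Lemma norm2_eq0 x : norm2 x = 0 -> x = 0.
Proof. by move=> h; apply: dotp_eq0; rewrite -norm2_sqr h expr0n. Qed.

Lemma norm2N x : norm2 (- x) = norm2 x.
Proof. by rewrite /norm2 dotpNl dotpNr opprK. Qed.

Lemma norm2Z a x : 0 <= a -> norm2 (a *: x) = a * norm2 x.
Proof.
move=> a0; rewrite /norm2 dotpZl dotpZr mulrA -expr2 sqrtrM ?sqr_ge0//.
by rewrite sqrtr_sqr ger0_norm.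
Qed.

Lemma norm2_le x a : 0 <= a -> (norm2 x <= a) = (dotp x x <= a ^+ 2).
Proof.
move=> a0; rewrite -norm2_sqr.
by rewrite ler_sqr// nnegrE// norm2_ge0.
Qed.

Lemma dotp_le x y : dotp x y <= norm2 x * norm2 y.
Proof.
have [x0|x0] := eqVneq (norm2 x) 0.
  by rewrite (norm2_eq0 x0) dotpC dotp0r mulr_ge0// norm2_ge0.
have [y0|y0] := eqVneq (norm2 y) 0.
  by rewrite (norm2_eq0 y0) dotp0r mulr_ge0// norm2_ge0.
have : 0 < norm2 x * norm2 y by rewrite mulr_gt0// lt0r ?x0 ?y0 norm2_ge0.
have := dotp_ge0 (norm2 y *: x - norm2 x *: y).
rewrite !(dotpBl, dotpBr, dotpZl, dotpZr) (dotpC y x) -!norm2_sqr => h p.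
rewrite -(ler_pM2l p); nra.
Qed.

Lemma normr_dotp_le x y : `|dotp x y| <= norm2 x * norm2 y.
Proof. by rewrite ler_norml dotp_le lerNl -dotpNl -(norm2N x) dotp_le. Qed.

(** The crude passage from the sup norm, which is what produces the factor
    sqrt d in the estimation rate. *)
Lemma norm2_le_sqrt_dim x a : 0 <= a -> (forall j, `|x j 0| <= a) ->
  norm2 x <= Num.sqrt d%:R * a.
Proof.
move=> a0 h; rewrite norm2_le; last by rewrite mulr_ge0// sqrtr_ge0.
rewrite exprMn sqr_sqrtr// mulr_natl -[d in X in _ <= X]card_ord -sumr_const.
apply: ler_sum => j _; rewrite -expr2 -(real_normK (num_real (x j 0))).
by rewrite ler_sqr ?nnegrE.
Qed.

End Euclid.

(** Columns are transposed in this section because the Heine-Borel and extreme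
   value theorems used below are about row vectors. *)
Section Compactness.
Context {R : realType} {d : nat}.

Let tr_coord_continuous j : continuous (fun u : 'rV[R]_d => u^T j 0).
Proof.
rewrite (_ : (fun u : 'rV[R]_d => u^T j 0) = fun u => u 0 j).
  exact: coord_continuous.
by apply/funext => u; rewrite mxE.
Qed.

Lemma continuous_dotp_tr (x : 'cV[R]_d) :
  continuous (fun u : 'rV[R]_d => dotp x u^T).
Proof.
rewrite /dotp; apply: continuous_sumr => j.
by apply: continuous_mulr; [exact: continuous_cst|exact: tr_coord_continuous].
Qed.

Lemma continuous_dotp_sqr_tr :
  continuous (fun u : 'rV[R]_d => dotp u^T u^T).
Proof.
rewrite /dotp; apply: continuous_sumr => j.
by apply: continuous_mulr; exact: tr_coord_continuous.
Qed.

Lemma compact_dotp_sqr (S : set R) r : closed S -> (forall t, S t -> t <= r) ->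
  compact [set u : 'rV[R]_d | S (dotp u^T u^T)].
Proof.
move=> cS Sr; apply: bounded_closed_compact; last first.
  by apply: (closed_comp _ cS) => u _; exact: continuous_dotp_sqr_tr.
exists (`|r| + 1); split; first exact: num_real.
move=> M rM u /= Su.
have M0 : 0 <= M by rewrite (le_trans _ (ltW rM))// addr_ge0.
rewrite [leLHS]/Num.norm /= mx_normrE; apply/bigmax_leP; split => //= -[i j] _ /=.
rewrite (ord1 i) -(@ler_pXn2r _ 2)// ?nnegrE// real_normK ?num_real//.
apply: (@le_trans _ _ (dotp u^T u^T)).
  rewrite /dotp (bigD1 j)//= !mxE -expr2 lerDl.
  by apply: sumr_ge0 => k _; rewrite -expr2 sqr_ge0.
apply: (le_trans (Sr _ Su)); apply: (le_trans (ler_norm r)).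
have : `|r| + 1 <= M by exact: ltW.
have := normr_ge0 r; nra.
Qed.

End Compactness.

Section Rayleigh.
Context {R : realType} {d n : nat} (x : 'I_n -> 'cV[R]_d).

(** The bilinear form of the Gram matrix. *)
Definition gram_form (u w : 'cV[R]_d) : R :=
  n%:R^-1 * \sum_(i < n) dotp (x i) u * dotp (x i) w.

Lemma gram_form_ge0 u : 0 <= gram_form u u.
Proof.
rewrite mulr_ge0// sumr_ge0// => i _; by rewrite -expr2 sqr_ge0.
Qed.

(** The Gram matrix applied to [u]. *)
Definition gram_vec (u : 'cV[R]_d) : 'cV[R]_d :=
  n%:R^-1 *: \sum_(i < n) dotp (x i) u *: x i.

Lemma dotp_gram_vec u w : dotp (gram_vec u) w = gram_form u w.
Proof.
rewrite dotpZl dotp_suml; congr (_ * _); apply: eq_bigr => i _.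
by rewrite dotpZl.
Qed.

Lemma gram_formDD u w : gram_form (u + w) (u + w) =
  gram_form u u + 2 * gram_form u w + gram_form w w.
Proof.
rewrite /gram_form [2 * _]mulrCA -!mulrDr; congr (_ * _); rewrite mulr_sumr -!big_split.
apply: eq_bigr => i _ /=; rewrite dotpDr; ring.
Qed.

Lemma gram_formZZ (a : R) u : gram_form (a *: u) (a *: u) = a ^+ 2 * gram_form u u.
Proof.
rewrite /gram_form mulrCA; congr (_ * _); rewrite mulr_sumr; apply: eq_bigr => i _.
rewrite dotpZr; ring.
Qed.

Lemma tr_mul_gram u : u^T *m gram x = (gram_vec u)^T.
Proof.
rewrite /gram /gram_vec -scalemxAr linearZ /=; congr (_ *: _).
rewrite mulmx_sumr raddf_sum; apply: eq_bigr => i _.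
rewrite mulmxA; apply/matrixP => p q; rewrite !mxE big_ord1 !mxE.
by rewrite (ord1 p); congr (_ * _); rewrite /dotp; apply: eq_bigr => j _; rewrite !mxE mulrC.
Qed.

(** A minimiser of the Rayleigh quotient on the unit sphere is an eigenvector,
    so the minimum is one of the eigenvalues and the least of them bounds the
    quadratic form from below. *)
Lemma lambda_min_le_gram_form u : (0 < d)%N ->
  lambda_min (gram x) * dotp u u <= gram_form u u.
Proof.
move=> d0.
pose S := [set v : 'rV[R]_d | [set 1 : R] (dotp v^T v^T)].
have cS : compact S.
  by apply: (@compact_dotp_sqr _ _ _ 1) => [|t /= ->//]; exact: closed_eq.
have S0 : S !=set0.
  exists (delta_mx 0 (Ordinal d0)) => /=.
  rewrite /S /= /dotp (bigD1 (Ordinal d0))//= big1 => [|j /negbTE jd].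
    by rewrite !mxE !eqxx mulr1 addr0.
  by rewrite !mxE jd andbF mulr0.
have cf : {within S, continuous (fun v : 'rV[R]_d => gram_form v^T v^T)}.
  apply: continuous_subspaceT; apply: continuous_mulr.
    exact: continuous_cst.
  apply: continuous_sumr => i.
  by apply: continuous_mulr; exact: continuous_dotp_tr.
have [v] := EVT_min_rV S0 cS cf.
rewrite inE /S /= => v1 vmin.
set a := gram_form v^T v^T in vmin.
have amin w : a * dotp w w <= gram_form w w.
  have [w0|w0] := eqVneq (dotp w w) 0.
    by rewrite w0 mulr0 gram_form_ge0.
  have w0' : norm2 w != 0 by apply: contra_neq w0; rewrite -norm2_sqr => ->; rewrite expr0n.
  have := vmin ((norm2 w)^-1 *: w)^T; rewrite trmxK gram_formZZ.
  rewrite inE /= trmxK dotpZl dotpZr mulrA -expr2 exprVn norm2_sqr mulVf//.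
  move=> /(_ erefl); rewrite ler_pdivlMl//.
  by rewrite mulrC.
  by rewrite lt0r w0 dotp_ge0.
have veig : gram_vec v^T = a *: v^T.
  apply/eqP; rewrite -subr_eq0; apply/eqP; apply: dotp_eq0.
  have [z zE] : exists z, z = gram_vec v^T - a *: v^T by eexists.
  rewrite -zE.
  pose g := gram_form z z - a * dotp z z.
  have g0 : 0 <= g by rewrite subr_ge0.
  set b := dotp z z.
  have bE : b = gram_form v^T z - a * dotp v^T z.
    by rewrite /b {1}zE dotpBl dotp_gram_vec dotpZl.
  (* The form minus [a] times the square norm is non-negative and vanishes at
     [v]; expanding it at [v + t z] leaves a quadratic in [t] without constant
     term, whose linear coefficient must vanish. *)
  have key t : 0 <= 2 * t * b + t ^+ 2 * g.
    have := amin (v^T + t *: z).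
    rewrite gram_formDD gram_formZZ !(dotpDl, dotpDr, dotpZl, dotpZr).
    have -> : gram_form v^T (t *: z) = t * gram_form v^T z.
      by rewrite -!dotp_gram_vec dotpZr.
    rewrite v1 (dotpC z) bE /g -/a -/b => h.
    by rewrite -subr_ge0 in h; apply: le_trans h _; rewrite le_eqVlt; apply/orP; left; apply/eqP; ring.
  have g1 : g + 1 != 0 by rewrite gt_eqF// ltr_wpDl.
  have := key (- b / (g + 1)).
  have -> : 2 * (- b / (g + 1)) * b + (- b / (g + 1)) ^+ 2 * g
      = - (b / (g + 1)) ^+ 2 * (g + 2) by field.
  rewrite mulNr oppr_ge0 pmulr_lle0; last by rewrite ltr_wpDl.
  move=> h; have /eqP : (b / (g + 1)) ^+ 2 = 0 by apply/eqP; rewrite eq_le h sqr_ge0.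
  by rewrite expf_eq0 /= mulf_eq0 invr_eq0 (negbTE g1) orbF => /eqP.
have aeig : eigenvalue (gram x) a.
  apply/eigenvalueP; exists v.
    by rewrite -[in LHS](trmxK v) tr_mul_gram veig linearZ /= trmxK.
  apply/eqP => v0; move: v1; rewrite v0 trmx0 dotp0r => /esym/eqP.
  by rewrite oner_eq0.
apply: le_trans (amin u); apply: ler_wpM2r; first exact: dotp_ge0.
apply: ge_inf => //.
exists 0 => b /eigenvalueP[w wb w0].
have : gram_form w^T w^T = b * dotp w^T w^T.
  rewrite -dotp_gram_vec -[gram_vec _]trmxK -tr_mul_gram trmxK wb.
  by rewrite linearZ /= dotpZl.
have := gram_form_ge0 w^T => h0 hb; move: h0; rewrite hb pmulr_lge0//.
rewrite lt0r dotp_ge0 andbT; apply: contra w0 => /eqP /dotp_eq0 wt.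
by rewrite -[w]trmxK wt trmx0.
Qed.

End Rayleigh.

Ltac nneg := repeat first
  [ done | by apply: ltW | exact: norm2_ge0 | exact: sqr_ge0 | exact: sqrtr_ge0
  | apply: mulr_ge0 | apply: exprn_ge0 | rewrite invr_ge0 | apply: addr_ge0 ].

(** * Strongly monotone ridge fields *)

Lemma dominated_continuous_at (R : realType) (T : topologicalType) (f h : T -> R)
    (t0 : T) : (forall t, `|f t - f t0| <= h t) -> h t0 = 0 ->
  {for t0, continuous h} -> {for t0, continuous f}.
Proof.
move=> fh h0 ch; apply/cvgrPdist_lt => e e0.
have : \forall t \near t0, h t < e.
  by apply: (cvgr_lt _ ch); rewrite h0.
by apply: filterS => t ht; rewrite distrC (le_lt_trans (fh t)).
Qed.

Lemma continuous_id (T : topologicalType) : continuous (@id T).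
Proof. by move=> t; exact: cvg_id. Qed.

Lemma continuous_normr (R : realType) (T : topologicalType) (f : T -> R) :
  continuous f -> continuous (fun t => `|f t|).
Proof. by move=> cf t; apply: cvg_norm; exact: cf. Qed.

Section Primitive.
Context {R : realType} (g : R -> R).
Hypotheses (cg : continuous g) (hg : {homo g : s t / s <= t}).

Let H (a b : R) := (\int[@lebesgue_measure R]_(t in `[a, b]) g t)%R.

Let ig a b : (@lebesgue_measure R).-integrable `[a, b] (EFin \o g).
Proof.
apply: continuous_compact_integrable; first exact: segment_compact.
exact: continuous_subspaceT.
Qed.

Let H_add a b c : a <= b -> b <= c -> H a c = H a b + H b c.
Proof.
move=> ab bc; have := @Rintegral_itvB _ g (BLeft a) (BRight c) b (ig a c).
rewrite !bnd_simp => /(_ ab bc) h.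
rewrite /H -(@Rintegral_itv_obnd_cbnd _ b (BRight c)).
  by rewrite -h addrC subrK.
apply: integrableS (ig b c) => //; apply: subset_itvr; by rewrite bnd_simp.
Qed.

Let H_cst a b r : a <= b ->
  (\int[@lebesgue_measure R]_(t in `[a, b]) r)%R = r * (b - a).
Proof.
move=> ab; have := lebesgue_measure_itv `[a, b]; rewrite /= lte_fin => mab.
rewrite Rintegral_cst//; congr (_ * _); rewrite [X in fine X]mab.
have [->|abn] := eqVneq a b; first by rewrite ltxx subrr.
by rewrite lt_neqAle abn ab.
Qed.

Let icst a b r : (@lebesgue_measure R).-integrable `[a, b] (EFin \o cst r).
Proof.
apply: continuous_compact_integrable; first exact: segment_compact.
by apply: continuous_subspaceT => ?; exact: cvg_cst.
Qed.

Let H_ge a b : a <= b -> g a * (b - a) <= H a b.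
Proof.
move=> ab; rewrite -H_cst//; apply: le_Rintegral => //; first exact: icst.
by move=> t /=; rewrite in_itv /= => /andP[at_ _]; exact: hg.
Qed.

Let H_le a b : a <= b -> H a b <= g b * (b - a).
Proof.
move=> ab; rewrite -H_cst//; apply: le_Rintegral => //; first exact: icst.
by move=> t /=; rewrite in_itv /= => /andP[_ tb]; exact: hg.
Qed.

(** A primitive of a non-decreasing function is convex; the subgradient
    inequality is its only property needed for minimisation. *)
Lemma convex_primitive : exists2 G : R -> R, continuous G &
  forall a b, g b * (a - b) <= G a - G b.
Proof.
pose G a := if 0 <= a then H 0 a else - H a 0.
have GB a b : a <= b -> G b - G a = H a b.
  move=> ab; rewrite /G; have [a0|/ltW a0] := leP 0 a.
    by rewrite (le_trans a0 ab) (H_add a0 ab) addrC addKr.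
  have [b0|/ltW b0] := leP 0 b; first by rewrite opprK addrC -H_add.
  by rewrite opprK (H_add ab b0) addrC addrK.
have key a b : g b * (a - b) <= G a - G b.
  have [ab|/ltW ba] := leP a b; last by rewrite GB// H_ge.
  by rewrite -(opprB (G b)) GB// -(opprB b) mulrN lerN2 H_le.
exists G => // b.
apply: (@dominated_continuous_at _ _ _ (fun a => (`|g a| + `|g b|) * `|a - b|)).
- move=> a; rewrite mulrDl -!normrM ler_norml; apply/andP; split.
    have := key a b; have := ler_norm (- (g b * (a - b))).
    have := normr_ge0 (g a * (a - b)); rewrite normrN; lra.
  have := key b a; have := ler_norm (g a * (a - b)).
  have := normr_ge0 (g b * (a - b)).
  have -> : g a * (b - a) = - (g a * (a - b)) by ring.
  lra.
- by rewrite subrr normr0 mulr0.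
- apply: continuous_mulr; [apply: continuous_addr|]; apply: continuous_normr.
  + exact: cg.
  + exact: continuous_cst.
  + by apply: continuous_subr; [exact: continuous_id|exact: continuous_cst].
Qed.

End Primitive.

Section MonotoneField.
Context {R : realType} {d n : nat} (x : 'I_n -> 'cV[R]_d) (lam : R).
Hypothesis lam0 : 0 < lam.

(** The gradient of a convex loss of the linear predictions with a ridge
    penalty, up to sign the ridge estimating function of the regression
    parameter. *)
Definition ridge_field (g : 'I_n -> R -> R) (u : 'cV[R]_d) : 'cV[R]_d :=
  \sum_(i < n) g i (dotp (x i) u) *: x i + lam *: u.

Lemma dotp_ridge_field g u w :
  dotp (ridge_field g u) w =
  \sum_(i < n) g i (dotp (x i) u) * dotp (x i) w + lam * dotp u w.
Proof.
rewrite dotpDl dotpZl dotp_suml; congr (_ + _); apply: eq_bigr => i _.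
by rewrite dotpZl.
Qed.

Lemma ridge_field_strongly_monotone g u w :
  (forall i, {homo g i : s t / s <= t}) ->
  lam * dotp (w - u) (w - u) <=
  dotp (ridge_field g w) (w - u) - dotp (ridge_field g u) (w - u).
Proof.
move=> hg; rewrite !dotp_ridge_field.
rewrite [dotp (w - u) _]dotpBl mulrBr opprD addrACA -sumrB lerDr.
apply: sumr_ge0 => i _; rewrite -mulrBl dotpBr.
have [h|/ltW h] := leP (dotp (x i) u) (dotp (x i) w).
  by rewrite mulr_ge0// subr_ge0// hg.
by rewrite mulr_le0// subr_le0// hg.
Qed.

(** The field is the gradient of a convex coercive function. A minimiser on a
    large ball is global, and the subgradient inequality at nearby points
    [v + h e] shows that the field is non-negative in every direction in the
    limit [h -> 0]. *)
Lemma ridge_field_zero g : (forall i, continuous (g i)) ->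
  (forall i, {homo g i : s t / s <= t}) -> exists u, ridge_field g u = 0.
Proof.
move=> cg hg.
have /choice[G hG] : forall i, exists G : R -> R, continuous G /\
    forall a b, g i b * (a - b) <= G a - G b.
  by move=> i; have [G cG hG] := convex_primitive (cg i) (hg i); exists G.
pose Phi (u : 'cV[R]_d) :=
  \sum_(i < n) G i (dotp (x i) u) + lam / 2 * dotp u u.
have PhiB u w : dotp (ridge_field g u) (w - u) <= Phi w - Phi u.
  rewrite dotp_ridge_field /Phi opprD addrACA -sumrB; apply: lerD.
    by apply: ler_sum => i _; rewrite dotpBr (hG i).2.
  rewrite dotpBr [leRHS](_ : _ = lam / 2 * (dotp w w - dotp u u)); last by ring.
  have := dotp_ge0 (w - u); rewrite !(dotpBl, dotpBr) (dotpC w u) => h.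
  have -> : lam * (dotp u w - dotp u u) = lam / 2 * (2 * dotp u w - 2 * dotp u u).
    by field.
  by apply: ler_wpM2l; [rewrite divr_ge0// ltW|lra].
pose K := norm2 (ridge_field g 0).
have K0 : 0 <= K by exact: norm2_ge0.
(* Beyond this radius the penalty exceeds the linear lower bound at 0. *)
pose r := 2 * K / lam.
have r0 : 0 <= r by rewrite divr_ge0 ?mulr_ge0// ltW.
pose S := [set v : 'rV[R]_d | [set t | t <= r ^+ 2] (dotp v^T v^T)].
have S0 : S 0 by rewrite /S /= trmx0 dotp0r sqr_ge0.
have cS : compact S.
  by apply: (@compact_dotp_sqr _ _ _ (r ^+ 2)) => //; exact: closed_le.
have cPhi : {within S, continuous (fun v : 'rV[R]_d => Phi v^T)}.
  apply: continuous_subspaceT; apply: continuous_addr.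
    apply: continuous_sumr => i v; apply: continuous_comp.
      exact: continuous_dotp_tr.
    exact: (hG i).1.
  apply: continuous_mulr; first exact: continuous_cst.
  exact: continuous_dotp_sqr_tr.
have [v _ vmin] := EVT_min_rV (ex_intro _ _ S0) cS cPhi.
have {}vmin w : Phi v^T <= Phi w.
  have [wr|wr] := leP (dotp w w) (r ^+ 2).
    by have := vmin w^T; rewrite inE /S /= trmxK; exact.
  have v0 : Phi v^T <= Phi 0.
    by have := vmin 0; rewrite inE trmx0; apply; rewrite /= dotp0r sqr_ge0.
  apply: (le_trans v0).
  have wr' : r < norm2 w by rewrite ltNge norm2_le// -ltNge.
  rewrite -subr_ge0 /Phi dotp0r mulr0 addr0.
  have h1 : dotp (ridge_field g 0) w <=
     \sum_(i < n) G i (dotp (x i) w) - \sum_(i < n) G i (dotp (x i) 0).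
    rewrite dotp_ridge_field [dotp 0 w]dotpC dotp0r mulr0 addr0 -sumrB.
    by apply: ler_sum => i _; rewrite -[X in _ * X]subr0 dotp0r (hG i).2.
  have h2 : - (K * norm2 w) <= dotp (ridge_field g 0) w.
    by have := normr_dotp_le (ridge_field g 0) w; rewrite ler_norml => /andP[].
  have h3 : K * norm2 w <= lam / 2 * dotp w w.
    rewrite -norm2_sqr expr2 mulrA ler_wpM2r ?norm2_ge0//.
    move: wr'; rewrite /r ltr_pdivrMr// => /ltW; lra.
  lra.
have Fge0 e : 0 <= dotp (ridge_field g v^T) e.
  pose k h := dotp (ridge_field g (v^T + h *: e)) e.
  have kE : k = fun h => \sum_(i < n)
      g i (dotp (x i) v^T + h * dotp (x i) e) * dotp (x i) e +
      lam * (dotp v^T e + h * dotp e e).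
    apply/funext => h; rewrite /k dotp_ridge_field dotpDl dotpZl.
    congr (_ + _); apply: eq_bigr => i _; by rewrite dotpDr dotpZr.
  have ck : continuous k.
    have aff a b : continuous (fun h : R => a + h * b).
      apply: continuous_addr; first exact: continuous_cst.
      by apply: continuous_mulr; [exact: continuous_id|exact: continuous_cst].
    rewrite kE; apply: continuous_addr.
      apply: continuous_sumr => i; apply: continuous_mulr; last exact: continuous_cst.
      by move=> h; apply: continuous_comp; [exact: aff|exact: cg].
    by apply: continuous_mulr; [exact: continuous_cst|exact: aff].
  have -> : dotp (ridge_field g v^T) e = k 0 by rewrite /k scale0r addr0.
  apply: (@cvgr_to_ge _ (0 : R)^'+ _ _ k).
    by apply: cvg_at_right_filter; exact: ck.
  near=> h; have h0 : 0 < h by [].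
  rewrite -(pmulr_rge0 _ h0) /k -dotpZr.
  have := PhiB (v^T + h *: e) v^T; rewrite opprD addrA subrr add0r dotpNr.
  have := vmin (v^T + h *: e); lra.
exists v^T; apply: dotp_eq0; apply/eqP; rewrite eq_le dotp_ge0 andbT.
by rewrite -oppr_ge0 -dotpNr Fge0.
Unshelve. all: by end_near.
Qed.

(** Strong monotonicity bounds the displacement of the zero by the change of the
    field at one of the zeros; this is how the zero inherits continuity in a
    parameter from the field. *)
Lemma ridge_zero_stable g g' u u' : (forall i, {homo g' i : s t / s <= t}) ->
  ridge_field g u = 0 -> ridge_field g' u' = 0 ->
  lam * norm2 (u' - u) <=
  \sum_(i < n) `|g' i (dotp (x i) u) - g i (dotp (x i) u)| * norm2 (x i).
Proof.
move=> hg' gu gu'; have := ridge_field_strongly_monotone u u' hg'.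
rewrite gu' (dotpC 0) dotp0r sub0r.
set D := \sum_(i < n) _; have D0 : 0 <= D.
  by apply: sumr_ge0 => i _; rewrite mulr_ge0// norm2_ge0.
have : dotp (ridge_field g u) (u' - u) = 0 by rewrite gu dotpC dotp0r.
rewrite !dotp_ridge_field => h0 h.
have : - (dotp (ridge_field g' u) (u' - u)) <= D * norm2 (u' - u).
  rewrite dotp_ridge_field (_ : - _ =
    \sum_(i < n) g i (dotp (x i) u) * dotp (x i) (u' - u) -
    \sum_(i < n) g' i (dotp (x i) u) * dotp (x i) (u' - u)); last by lra.
  rewrite -sumrB.
  rewrite /D mulr_suml; apply: ler_sum => i _.
  rewrite -mulrBl -mulrA; apply: (le_trans (ler_norm _)).
  rewrite normrM distrC.
  by apply: ler_wpM2l => //; exact: normr_dotp_le.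
rewrite dotp_ridge_field => h1.
have := le_trans h h1; rewrite -norm2_sqr expr2 mulrA.
have [n0|n0] := eqVneq (norm2 (u' - u)) 0; first by rewrite n0 !mulr0.
by rewrite ler_pM2r// lt0r n0 norm2_ge0.
Qed.

(** Outward pointing on a sphere confines the zero: by monotonicity along the
    segment from a centre to a zero outside the ball, the field would point
    strictly inward where that segment leaves the ball. *)
Lemma ridge_zero_in_ball g u c r : 0 < r -> (forall i, {homo g i : s t / s <= t}) ->
  ridge_field g u = 0 ->
  (forall e, norm2 e = r -> 0 <= dotp (ridge_field g (c + e)) e) ->
  norm2 (u - c) <= r.
Proof.
move=> r0 hg gu hs; rewrite leNgt; apply/negP => ru.
set N := norm2 (u - c) in ru; have N0 : 0 < N by exact: lt_trans ru.
have [e eE] : exists e, e = (r / N) *: (u - c) by eexists.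
have eN : norm2 e = r by rewrite eE norm2Z ?divr_ge0 ?ltW// -/N mulfVK// gt_eqF.
have uce : u - (c + e) = (N / r - 1) *: e.
  rewrite scalerBl scale1r eE scalerA opprD addrA; congr (_ - _).
  rewrite (_ : N / r * (r / N) = 1) ?scale1r//.
  by field; rewrite !gt_eqF.
have := ridge_field_strongly_monotone (c + e) u hg.
rewrite gu (dotpC 0) dotp0r sub0r uce !dotpZr dotpZl -norm2_sqr eN.
have p : 0 < N / r - 1 by rewrite subr_gt0 ltr_pdivlMr// mul1r.
have := hs _ eN => h1 h2.
have : 0 < lam * ((N / r - 1) * ((N / r - 1) * r ^+ 2)).
  by rewrite !mulr_gt0// exprn_gt0.
have : 0 <= (N / r - 1) * dotp (ridge_field g (c + e)) e by rewrite mulr_ge0// ltW.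
lra.
Qed.

Lemma ridge_zero_path (g : R -> 'I_n -> R -> R) :
  (forall s i, continuous (g s i)) ->
  (forall s i, {homo g s i : t t' / t <= t'}) ->
  (forall i t, continuous (fun s => g s i t)) ->
  exists2 u : R -> 'cV[R]_d, forall s, ridge_field (g s) (u s) = 0 &
    forall i, continuous (fun s => dotp (x i) (u s)).
Proof.
move=> cg hg cgs.
have /choice[u hu] : forall s, exists u, ridge_field (g s) u = 0.
  by move=> s; apply: ridge_field_zero; [exact: cg|exact: hg].
exists u => // i s0.
pose m s := norm2 (x i) / lam * \sum_(j < n)
  `|g s j (dotp (x j) (u s0)) - g s0 j (dotp (x j) (u s0))| * norm2 (x j).
apply: (@dominated_continuous_at _ _ _ m).
- move=> s; rewrite -dotpBr; apply: (le_trans (normr_dotp_le _ _)).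
  rewrite /m -mulrA ler_wpM2l ?norm2_ge0// ler_pdivlMl//.
  exact: ridge_zero_stable.
- by rewrite /m big1 ?mulr0// => j _; rewrite subrr normr0 mul0r.
- apply: continuous_mulr; first exact: continuous_cst.
  apply: continuous_sumr => j; apply: continuous_mulr; last exact: continuous_cst.
  by apply: continuous_normr; apply: continuous_subr; [exact: cgs|exact: continuous_cst].
Qed.

End MonotoneField.

(** * The estimating equations on a good sample *)

Section Curvature.
Context {R : realType} (psi : R -> R).
Hypothesis hpsi : influence_function 2 psi.

Lemma mul_influence_shift_le a r s k : 0 <= k ->
  a * psi (r * s - k * a) <= a * psi (r * s).
Proof.
case: hpsi => _ hm _ _ k0; have [a0|/ltW a0] := leP 0 a.
  by apply: ler_wpM2l => //; apply: hm; rewrite gerBl mulr_ge0.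
by apply: ler_wnM2l => //; apply: hm; rewrite lerBrDr gerDl mulr_ge0_le0.
Qed.

(** Restricted curvature without derivatives of [psi]: where [`|s|] is at most
    1 the two-sided quadratic error bound leaves half of the linear decrease, and
    where it exceeds 1 monotonicity suffices because the logarithm, which
    measures how many such terms there are, is then at least 1/2. *)
Lemma mul_influence_curvature_le a r s k : 0 <= k -> 0 < r -> r ^+ 2 <= 3 / 2 ->
  `|k * a| <= 1 / 2 ->
  a * psi (r * s - k * a) <= a * psi (r * s) - k * a ^+ 2 / 2 +
    (9 / 2 * `|a| + k * a ^+ 2) * ln (1 + s ^+ 2).
Proof.
move=> k0 r0 r2 ka.
have s2 := sqr_ge0 s; have a2 : 0 <= k * a ^+ 2 by rewrite mulr_ge0 ?sqr_ge0.
have ln0 : 0 <= ln (1 + s ^+ 2) by apply: ln_ge0; lra.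
have [s1|/ltW s1] := leP (s ^+ 2) 1; last first.
  have h := mul_influence_shift_le a r s k0.
  have h1 := ln1D_ge_half s1.
  have : 0 <= 9 / 2 * `|a| * ln (1 + s ^+ 2) by rewrite !mulr_ge0.
  have : 1 / 2 * (k * a ^+ 2) <= ln (1 + s ^+ 2) * (k * a ^+ 2).
    exact: ler_wpM2r.
  lra.
have h1 := influence2_sub_le (r * s - k * a) hpsi.
have h2 := influence2_sub_le (r * s) hpsi.
have h3 : s ^+ 2 / 2 <= ln (1 + s ^+ 2) by apply: half_le_ln1D; rewrite s2.
set u := psi (r * s - k * a) in h1 *; set v := psi (r * s) in h2 *.
have err : `|u - v + k * a| <= 9 / 4 * s ^+ 2 + (k * a) ^+ 2.
  have -> : u - v + k * a = (u - (r * s - k * a)) - (v - r * s) by ring.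
  apply: (le_trans (ler_normB _ _)).
  have : (r * s) ^+ 2 <= 3 / 2 * s ^+ 2 by rewrite exprMn; apply: ler_wpM2r.
  have := sqr_ge0 (r * s + k * a).
  rewrite sqrrB in h1; rewrite sqrrD; lra.
have h4 : a * (u - v + k * a) <= `|a| * (9 / 4 * s ^+ 2 + (k * a) ^+ 2).
  by apply: (le_trans (ler_norm _)); rewrite normrM ler_wpM2l.
have h5 : `|a| * (k * a) ^+ 2 <= k * a ^+ 2 / 2.
  have -> : (k * a) ^+ 2 = `|k * a| * `|k * a|.
    by rewrite -expr2 real_normK ?num_real.
  have -> : k * a ^+ 2 / 2 = `|a| * (`|k * a| * (1 / 2)).
    by rewrite normrM (ger0_norm k0) -[a ^+ 2]real_normK ?num_real//; field.
  by rewrite ler_wpM2l// ler_wpM2l.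
have h6 : `|a| * (9 / 4 * s ^+ 2) <= 9 / 2 * `|a| * ln (1 + s ^+ 2).
  have -> : 9 / 2 * `|a| * ln (1 + s ^+ 2) = `|a| * (9 / 2 * ln (1 + s ^+ 2)) by ring.
  by rewrite ler_wpM2l//; lra.
have : 0 <= k * a ^+ 2 * ln (1 + s ^+ 2) by rewrite mulr_ge0.
lra.
Qed.

End Curvature.

Section Deterministic.
Context {R : realType} {d n : nat}.
Variables (x : 'I_n -> 'cV[R]_d) (y noise : 'I_n -> R) (thetastar : 'cV[R]_d).
Variables (psi1 psi2 : R -> R) (a1 a2 lam0 sigma c_l L t0 e' : R).
Hypotheses (d0 : (0 < d)%N) (n0 : (0 < n)%N).
Hypothesis hmodel : forall i, y i = dotp (x i) thetastar + noise i.
Hypotheses (hpsi1 : influence_function 2 psi1).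
Hypotheses (cpsi2 : continuous psi2) (mpsi2 : {homo psi2 : s t / s <= t}).
Hypotheses (a1_gt0 : 0 < a1) (a2_gt0 : 0 < a2) (lam0_gt0 : 0 < lam0).
Hypotheses (sigma_gt0 : 0 < sigma) (c_l_gt0 : 0 < c_l) (L_gt0 : 0 < L).
Hypotheses (t0_gt0 : 0 < t0) (e'_gt0 : 0 < e') (e'_lt : e' <= 1 / 2).
Hypothesis hx : forall i, norm2 (x i) <= L.
Hypothesis hgram : forall u, c_l * dotp u u <= gram_form x u u.
Hypothesis hrate : 100 * (Num.sqrt d%:R * L * a1 + lam0 * norm2 thetastar)
  <= t0 * (lam0 + c_l / sigma).
Hypothesis hsmall : t0 * (1 + L ^+ 2 / sigma ^+ 2) <= 1 / 2.

Let std i := a1 * (noise i / sigma).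

Hypothesis score_le : forall j,
  `|\sum_(i < n) x i j 0 * psi1 (std i)| <= n%:R * (L * a1 ^+ 2).
Hypothesis logs_le : \sum_(i < n) ln (1 + std i ^+ 2) <= 3 / 2 * (n%:R * a1 ^+ 2).

Let N0 : 0 < n%:R :> R. Proof. by rewrite ltr0n. Qed.

Let logs_ge0 i : 0 <= ln (1 + std i ^+ 2).
Proof. by apply: ln_ge0; rewrite lerDl sqr_ge0. Qed.

Let pred_le e i : `|dotp (x i) e| <= L * norm2 e.
Proof.
apply: (le_trans (normr_dotp_le _ _)); apply: ler_wpM2r; first exact: norm2_ge0.
exact: hx.
Qed.

Let sqrt_d_ge1 : 1 <= Num.sqrt d%:R :> R.
Proof. by rewrite -[leLHS]sqrtr1 ler_wsqrtr// ler1n. Qed.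

Let score_dotp_le e :
  \sum_(i < n) dotp (x i) e * psi1 (std i) <=
  n%:R * (Num.sqrt d%:R * L * a1 ^+ 2 * norm2 e).
Proof.
pose z := \sum_(i < n) psi1 (std i) *: x i.
have -> : \sum_(i < n) dotp (x i) e * psi1 (std i) = dotp z e.
  by rewrite dotp_suml; apply: eq_bigr => i _; rewrite dotpZl mulrC.
apply: (le_trans (dotp_le _ _)); rewrite mulrA; apply: ler_wpM2r.
  exact: norm2_ge0.
rewrite -mulrA mulrCA; apply: norm2_le_sqrt_dim.
  by rewrite !mulr_ge0// ?ler0n// ?ltW// exprn_gt0.
move=> j; rewrite summxE (eq_bigr (fun i => x i j 0 * psi1 (std i))) ?score_le//.
by move=> i _; rewrite mxE mulrC.
Qed.

(** The scale enters the score only through the factor [r], up to an error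
    controlled by the logarithms; hence one event handles all scales. *)
Let scaled_score_le r e : 0 < r -> r ^+ 2 <= 3 / 2 ->
  \sum_(i < n) dotp (x i) e * psi1 (r * std i) <=
  n%:R * (9 * (Num.sqrt d%:R * L * a1 ^+ 2) * norm2 e).
Proof.
move=> r0 r2; have r1 : r <= 5 / 4 by nra.
have h1 : \sum_(i < n) dotp (x i) e * psi1 (r * std i) <=
    r * (\sum_(i < n) dotp (x i) e * psi1 (std i)) +
    5 * (L * norm2 e) * \sum_(i < n) ln (1 + std i ^+ 2).
  rewrite !mulr_sumr -big_split; apply: ler_sum => i _ /=.
  have := influence2_scale_le (std i) hpsi1 r0 r2.
  set u := psi1 (r * std i); set v := psi1 (std i) => huv.
  rewrite -lerBlDl (_ : _ - _ = dotp (x i) e * (u - r * v)); last by ring.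
  apply: (le_trans (ler_norm _)); rewrite normrM.
  rewrite (_ : 5 * _ * _ = L * norm2 e * (5 * ln (1 + std i ^+ 2))); last by ring.
  exact: ler_pM.
have h2 := score_dotp_le e.
have Ne := norm2_ge0 e.
pose D := n%:R * (L * a1 ^+ 2 * norm2 e).
have D0 : 0 <= D by rewrite !mulr_ge0// ?ltW// exprn_gt0.
have h3 : r * (\sum_(i < n) dotp (x i) e * psi1 (std i)) <= 5 / 4 * (Num.sqrt d%:R * D).
  have -> : Num.sqrt d%:R * D = n%:R * (Num.sqrt d%:R * L * a1 ^+ 2 * norm2 e).
    by rewrite /D; ring.
  apply: (le_trans (ler_wpM2l (ltW r0) h2)); apply: ler_wpM2r => //.
  by rewrite !mulr_ge0// ?ltW// exprn_gt0.
have h4 : 5 * (L * norm2 e) * \sum_(i < n) ln (1 + std i ^+ 2) <= 15 / 2 * D.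
  have -> : 15 / 2 * D = 5 * (L * norm2 e) * (3 / 2 * (n%:R * a1 ^+ 2)).
    by rewrite /D; field.
  by apply: ler_wpM2l => //; rewrite !mulr_ge0// ltW.
have h5 : D <= Num.sqrt d%:R * D by rewrite ler_peMl.
have -> : n%:R * (9 * (Num.sqrt d%:R * L * a1 ^+ 2) * norm2 e) = 9 * (Num.sqrt d%:R * D).
  by rewrite /D; ring.
lra.
Qed.

(** If the penalty does not dominate, the smallness of [t0] forces [a1] to be
    small relative to the least eigenvalue. *)
Let small_gram : lam0 * sigma < c_l -> 6 * (a1 ^+ 2 * L ^+ 2) <= c_l /\ c_l <= L ^+ 2.
Proof.
move=> lc.
have cL : c_l <= L ^+ 2.
  pose e : 'cV[R]_d := const_mx 1.
  have e0 : 0 < dotp e e.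
    rewrite /dotp (eq_bigr (fun=> 1)) => [|j _]; last by rewrite !mxE mulr1.
    by rewrite sumr_const card_ord ltr0n.
  rewrite -(ler_pM2r e0); apply: (le_trans (hgram e)).
  rewrite /gram_form ler_pdivrMl//.
  rewrite (_ : n%:R * _ = \sum_(i < n) L ^+ 2 * dotp e e); last first.
    by rewrite sumr_const card_ord mulr_natl.
  apply: ler_sum => i _; rewrite -expr2 -norm2_sqr -exprMn.
  rewrite -[leLHS]real_normK ?num_real// ler_sqr ?nnegrE ?pred_le//.
  by rewrite mulr_ge0 ?norm2_ge0// ltW.
split => //.
have h1 : L * a1 <= Num.sqrt d%:R * L * a1.
  by rewrite -[leLHS]mul1r -mulrA ler_wpM2r// mulr_ge0// ltW.
have h2 : lam0 <= c_l / sigma by rewrite ler_pdivlMr// ltW.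
have h3 : t0 * (lam0 + c_l / sigma) <= t0 * (2 * (c_l / sigma)).
  by rewrite (ler_wpM2l (ltW t0_gt0))//; lra.
have h4 : 0 <= lam0 * norm2 thetastar by rewrite mulr_ge0 ?norm2_ge0 ?ltW.
have h5 : L * a1 <= c_l * (t0 / sigma) / 50.
  have -> : c_l * (t0 / sigma) / 50 = t0 * (2 * (c_l / sigma)) / 100.
    by field; rewrite gt_eqF.
  move: hrate; lra.
have ts : L * (t0 / sigma) <= 1 / 2.
  have q0 : 0 <= L / sigma by rewrite divr_ge0 ?ltW.
  move: hsmall; rewrite -expr_div_n.
  have -> : L * (t0 / sigma) = t0 * (L / sigma) by field; rewrite gt_eqF.
  have := sqr_ge0 (L / sigma - 1); nra.
have ts0 : 0 <= t0 / sigma by rewrite divr_ge0 ?ltW.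
have h6 : a1 ^+ 2 * L ^+ 2 <= (c_l * (t0 / sigma) / 50) ^+ 2.
  rewrite -exprMn ler_sqr ?nnegrE.
  - by rewrite mulrC.
  - nneg.
  - nneg.
have h7 : c_l * (t0 / sigma) ^+ 2 <= 1 / 4.
  apply: (@le_trans _ _ ((L * (t0 / sigma)) ^+ 2)).
    by rewrite [leRHS]exprMn ler_wpM2r ?sqr_ge0.
  have -> : 1 / 4 = (1 / 2) ^+ 2 :> R by field.
  by rewrite ler_sqr ?nnegrE//; nneg.
have h8 : (c_l * (t0 / sigma) / 50) ^+ 2 <= c_l / 6.
  have -> : (c_l * (t0 / sigma) / 50) ^+ 2 = c_l * (c_l * (t0 / sigma) ^+ 2) / 2500.
    by field; rewrite gt_eqF.
  have : c_l * (c_l * (t0 / sigma) ^+ 2) <= c_l * (1 / 4).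
    by rewrite ler_wpM2l// ltW.
  move: c_l_gt0; lra.
lra.
Qed.

(** The field points outwards on the sphere of radius [t0]. If
    [c_l <= lam0 * sigma] the penalty suffices and monotonicity disposes of the
    residual shift; otherwise the shift contributes curvature [c_l / sigma]. The
    constant 100 in [hrate] covers six times the 9 + 7 units of noise and error. *)
Let residual_score_le r e : 0 < r -> 1 / 2 <= r ^+ 2 -> r ^+ 2 <= 3 / 2 ->
  norm2 e = t0 ->
  n%:R^-1 * \sum_(i < n) dotp (x i) e * psi1 (r * std i - a1 * r / sigma * dotp (x i) e)
  <= lam0 * a1 * dotp (thetastar + e) e.
Proof.
move=> r0 rl ru eN; have r1 : r <= 5 / 4 by nra.
have r7 : 7 / 10 <= r by nra.
set k := a1 * r / sigma.
have k0 : 0 <= k by rewrite !mulr_ge0// ?invr_ge0 ltW.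
pose A := Num.sqrt d%:R * L * a1.
have A0 : 0 <= A by rewrite !mulr_ge0// ltW.
have hth : - (norm2 thetastar * t0) <= dotp thetastar e.
  by have := normr_dotp_le thetastar e; rewrite eN ler_norml => /andP[].
have dE : lam0 * a1 * (t0 ^+ 2 - norm2 thetastar * t0) <=
    lam0 * a1 * dotp (thetastar + e) e.
  rewrite dotpDl -norm2_sqr eN ler_wpM2l//; first by rewrite mulr_ge0 ?ltW.
  lra.
apply: le_trans dE; rewrite ler_pdivrMl//.
have hs := scaled_score_le e r0 ru; rewrite eN in hs.
have [cl|lc] := leP c_l (lam0 * sigma).
  apply: (le_trans (ler_sum _ (fun i _ =>
    mul_influence_shift_le hpsi1 (dotp (x i) e) r (std i) k0))).
  apply: (le_trans hs); rewrite ler_pM2l//.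
  have h : c_l / sigma <= lam0 by rewrite ler_pdivrMr.
  have h1 : t0 * (lam0 + c_l / sigma) <= t0 * (2 * lam0).
    by rewrite (ler_wpM2l (ltW t0_gt0))//; lra.
  have -> : 9 * (Num.sqrt d%:R * L * a1 ^+ 2) * t0 = a1 * t0 * (9 * A) by rewrite /A; ring.
  have -> : lam0 * a1 * (t0 ^+ 2 - norm2 thetastar * t0) =
    a1 * t0 * (lam0 * t0 - lam0 * norm2 thetastar) by ring.
  apply: ler_wpM2l; first by nneg.
  have h4 : 0 <= lam0 * norm2 thetastar by rewrite mulr_ge0 ?norm2_ge0 ?ltW.
  move: hrate h1; rewrite -/A; lra.
have [aL cL] := small_gram lc.
have a1h : a1 <= 1 / 2.
  have : a1 ^+ 2 * 6 <= 1.
    rewrite -(ler_pM2r (_ : 0 < L ^+ 2)) ?exprn_gt0//; lra.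
  have := a1_gt0; nra.
have tL : L * (t0 / sigma) <= 1 / 4.
  have q0 : 0 <= L / sigma by rewrite divr_ge0 ?ltW.
  move: hsmall; rewrite -expr_div_n.
  have -> : L * (t0 / sigma) = t0 * (L / sigma) by field; rewrite gt_eqF.
  have := sqr_ge0 (L / sigma - 1); nra.
have ka i : `|k * dotp (x i) e| <= 1 / 2.
  rewrite normrM (ger0_norm k0); apply: (@le_trans _ _ (k * (L * t0))).
    by apply: ler_wpM2l => //; rewrite -eN pred_le.
  have -> : k * (L * t0) = a1 * r * (L * (t0 / sigma)) by rewrite /k; field; rewrite gt_eqF.
  apply: (@le_trans _ _ (1 / 2 * (5 / 4) * (1 / 4))); last by lra.
  have ts0 : 0 <= L * (t0 / sigma) by rewrite mulr_ge0 ?divr_ge0 ?ltW.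
  apply: ler_pM => //; first by nneg.
  by apply: ler_pM => //; nneg.
apply: (le_trans (ler_sum _ (fun i _ =>
  mul_influence_curvature_le hpsi1 (std i) k0 r0 ru (ka i)))).
rewrite big_split sumrB /=.
have hq : n%:R * (k / 2 * (c_l * t0 ^+ 2)) <=
    \sum_(i < n) k * dotp (x i) e ^+ 2 / 2.
  rewrite -eN norm2_sqr; apply: (@le_trans _ _ (n%:R * (k / 2 * gram_form x e e))).
    by apply: ler_wpM2l; [exact: ltW|apply: ler_wpM2l => //; rewrite divr_ge0].
  rewrite /gram_form [n%:R * _]mulrCA mulVKf ?gt_eqF// mulr_sumr.
  by apply: ler_sum => i _; rewrite -expr2 mulrAC.
have hl : \sum_(i < n) (9 / 2 * `|dotp (x i) e| + k * dotp (x i) e ^+ 2) *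
      ln (1 + std i ^+ 2) <=
    n%:R * ((9 / 2 * (L * t0) + k * (L ^+ 2 * t0 ^+ 2)) * (3 / 2 * a1 ^+ 2)).
  apply: (@le_trans _ _ (\sum_(i < n) (9 / 2 * (L * t0) + k * (L ^+ 2 * t0 ^+ 2)) *
      ln (1 + std i ^+ 2))).
    apply: ler_sum => i _; apply: ler_wpM2r => //; apply: lerD.
      by rewrite ler_wpM2l// -eN pred_le.
    rewrite ler_wpM2l// -exprMn -[leLHS]real_normK ?num_real//.
    by rewrite ler_sqr ?nnegrE//; [rewrite -eN pred_le|nneg].
  rewrite -mulr_sumr [n%:R * _]mulrCA [n%:R * _]mulrCA; apply: ler_wpM2l => //.
  by nneg.
have Ls : L * a1 <= A.
  by rewrite -[leLHS]mul1r /A -mulrA ler_wpM2r// mulr_ge0// ltW.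
apply: (le_trans (lerD (lerB hs hq) hl)).
rewrite -mulrBr -mulrDr ler_pM2l//.
have kl : 7 / 10 * (a1 / sigma) <= k.
  by rewrite (_ : k = r * (a1 / sigma)); [apply: ler_wpM2r => //; nneg|rewrite /k; ring].
have h1 : k * (L ^+ 2 * t0 ^+ 2) * (3 / 2 * a1 ^+ 2) <= k * t0 ^+ 2 * (c_l / 4).
  have -> : k * (L ^+ 2 * t0 ^+ 2) * (3 / 2 * a1 ^+ 2) =
    k * t0 ^+ 2 * (3 / 2 * (a1 ^+ 2 * L ^+ 2)) by ring.
  by apply: ler_wpM2l; [nneg|lra].
have h2 : 7 / 10 * (a1 / sigma) * (t0 ^+ 2 * (c_l / 4)) <= k * (t0 ^+ 2 * (c_l / 4)).
  by apply: ler_wpM2r => //; nneg.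
have h3 : a1 * t0 * (L * a1) <= a1 * t0 * A.
  by apply: ler_wpM2l => //; nneg.
have h4 : a1 * t0 * (100 * (A + lam0 * norm2 thetastar)) <=
    a1 * t0 * (t0 * (lam0 + c_l / sigma)).
  by apply: ler_wpM2l => //; nneg.
have h5 : 0 <= a1 * t0 * (lam0 * norm2 thetastar).
  by rewrite !mulr_ge0 ?norm2_ge0 ?ltW.
have h6 : 0 <= a1 * t0 * (t0 * lam0) by rewrite !mulr_ge0 ?ltW.
have h7 : 0 <= a1 * t0 * (t0 * (c_l / sigma)) by rewrite !mulr_ge0 ?invr_ge0 ?ltW.
move: h1 h2 h3 h4 h5 h6 h7.
have -> : 7 / 10 * (a1 / sigma) * (t0 ^+ 2 * (c_l / 4)) =
  7 / 40 * (a1 * t0 * (t0 * (c_l / sigma))) by field; rewrite gt_eqF.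
have -> : 9 * (Num.sqrt d%:R * L * a1 ^+ 2) * t0 = 9 * (a1 * t0 * A) by rewrite /A; ring.
lra.
Qed.

Hypothesis scale_low : 0 <= \sum_(i < n) psi2 (a2 *
  ((1 + e') * (1 - t0) * (noise i / sigma) ^+ 2 -
   (1 + (1 + e') * t0 * (L ^+ 2 / sigma ^+ 2)))).
Hypothesis scale_high : \sum_(i < n) psi2 (a2 *
  ((1 - e') * (1 + t0) * (noise i / sigma) ^+ 2 -
   (1 - 2 * (1 - e') * t0 * (L ^+ 2 / sigma ^+ 2)))) <= 0.

(** Existence by the intermediate value theorem: for each inverse scale [s] the
    regression equation has a unique zero, it stays in the ball of radius [t0]
    and depends continuously on [s], and along this path the scale equation
    changes sign. *)
Lemma ridge_system_solution : exists (theta : 'cV[R]_d) (v : R),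
  [/\ 0 < v,
      f1_ridge psi1 a1 lam0 x y theta v = 0,
      f2_ridge psi2 a2 x y theta v = 0,
      norm2 (thetastar - theta) <= t0
    & sigma ^+ 2 <= (1 + e') * v ^+ 2 /\ (1 - e') * v ^+ 2 <= sigma ^+ 2].
Proof.
have lam_gt0 : 0 < lam0 * a1 by rewrite mulr_gt0.
have [cpsi1 mpsi1 _ _] := hpsi1.
pose g (s : R) (i : 'I_n) (t : R) := - (n%:R^-1 * psi1 (a1 * ((y i - t) * `|s|))).
have cg_t s i : continuous (g s i).
  move=> t; apply: cvgN; apply: cvgMr.
  apply: (@continuous_comp _ _ _ (fun t => a1 * ((y i - t) * `|s|)) psi1);
    last exact: cpsi1.
  apply: cvgMr; apply: cvgMl; apply: cvgB; [exact: cvg_cst|exact: cvg_id].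
have cg_s i t : continuous (fun s => g s i t).
  move=> s; apply: cvgN; apply: cvgMr.
  apply: (@continuous_comp _ _ _ (fun s => a1 * ((y i - t) * `|s|)) psi1);
    last exact: cpsi1.
  by apply: cvgMr; apply: cvgMr; apply: cvg_norm; exact: cvg_id.
have mg s i : {homo g s i : t t' / t <= t'}.
  move=> t t' tt'; rewrite /g lerN2 ler_pM2l ?invr_gt0//; apply: mpsi1.
  by rewrite ler_pM2l// ler_wpM2r// lerD2l lerN2.
have [u hu cu] := ridge_zero_path x lam_gt0 cg_t mg cg_s.
have u_ball s : 0 < s -> 1 / 2 <= (sigma * s) ^+ 2 -> (sigma * s) ^+ 2 <= 3 / 2 ->
    norm2 (u s - thetastar) <= t0.
  move=> s0 sl su; apply: (ridge_zero_in_ball lam_gt0 t0_gt0 (mg s) (hu s)) => e eN.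
  have := residual_score_le (mulr_gt0 sigma_gt0 s0) sl su eN.
  rewrite dotp_ridge_field -subr_ge0 => h; apply: le_trans h _.
  rewrite addrC lerD2r mulr_sumr -sumrN; apply: ler_sum => i _.
  rewrite /g mulNr lerN2 mulrAC -mulrA; apply: ler_wpM2l; first by rewrite invr_ge0 ltW.
  rewrite le_eqVlt; apply/orP; left; apply/eqP; congr (_ * psi1 _).
  by rewrite hmodel dotpDr (gtr0_norm s0) /std; field; rewrite gt_eqF.
pose f (s : R) := \sum_(i < n) psi2 (a2 * ((y i - dotp (x i) (u s)) ^+ 2 * s ^+ 2 - 1)).
have cf : continuous f.
  apply: continuous_sumr => i s.
  apply: (@continuous_comp _ _ _ (fun s => a2 *
    ((y i - dotp (x i) (u s)) ^+ 2 * s ^+ 2 - 1)) psi2); last exact: cpsi2.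
  have cs : continuous (fun s : R => y i - dotp (x i) (u s)).
    by apply: continuous_subr; [exact: continuous_cst|exact: cu].
  apply: continuous_mulr; first exact: continuous_cst.
  apply: continuous_subr; last exact: continuous_cst.
  by apply: continuous_mulr; apply: continuous_mulr => //; exact: continuous_id.
have q0 : 0 <= L ^+ 2 / sigma ^+ 2 by nneg.
have t0h : t0 <= 1 / 2 by move: hsmall t0_gt0; nra.
pose s_at (c : R) := Num.sqrt c / sigma.
have s_at_gt0 c : 0 < c -> 0 < s_at c by move=> c0; rewrite divr_gt0// sqrtr_gt0.
have s_at_sqr c : 0 <= c -> (sigma * s_at c) ^+ 2 = c.
  by move=> c0; rewrite /s_at mulrCA divff ?gt_eqF// mulr1 sqr_sqrtr.
have resid s i : y i - dotp (x i) (u s) = noise i - dotp (x i) (u s - thetastar).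
  by rewrite hmodel dotpBr; ring.
have predsq s i : norm2 (u s - thetastar) <= t0 ->
    dotp (x i) (u s - thetastar) ^+ 2 <= L ^+ 2 * t0 ^+ 2.
  move=> ut; rewrite -exprMn -[leLHS]real_normK ?num_real//.
  rewrite ler_sqr ?nnegrE//; last by nneg.
  apply: (le_trans (normr_dotp_le _ _)); apply: ler_pM => //; exact: norm2_ge0.
have scaleE c i : 0 < c -> (y i - dotp (x i) (u (s_at c))) ^+ 2 * s_at c ^+ 2 =
    c * ((noise i - dotp (x i) (u (s_at c) - thetastar)) ^+ 2 / sigma ^+ 2).
  move=> c0; rewrite resid -{3}(s_at_sqr _ (ltW c0)).
  by field; rewrite gt_eqF.
have f_high : 0 <= f (s_at (1 + e')).
  have c0 : 0 < 1 + e' by rewrite addr_gt0.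
  apply: (le_trans scale_low); apply: ler_sum => i _; apply: mpsi2.
  rewrite ler_pM2l// scaleE//.
  have /predsq : norm2 (u (s_at (1 + e')) - thetastar) <= t0.
    apply: u_ball; rewrite ?s_at_gt0 ?(s_at_sqr _ (ltW c0))//; move: e'_lt e'_gt0; lra.
  move=> /(_ i); set a := dotp _ _ => ha.
  have h : (1 - t0) * noise i ^+ 2 - t0 * L ^+ 2 <= (noise i - a) ^+ 2.
    rewrite -subr_ge0 -(pmulr_rge0 _ t0_gt0).
    have -> : t0 * ((noise i - a) ^+ 2 - ((1 - t0) * noise i ^+ 2 - t0 * L ^+ 2)) =
      (t0 * noise i - a) ^+ 2 + t0 * a ^+ 2 + (L ^+ 2 * t0 ^+ 2 - a ^+ 2) by ring.
    by apply: addr_ge0; [nneg|rewrite subr_ge0].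
  have : (1 + e') * (((1 - t0) * noise i ^+ 2 - t0 * L ^+ 2) / sigma ^+ 2) <=
      (1 + e') * ((noise i - a) ^+ 2 / sigma ^+ 2).
    by rewrite ler_pM2l// ler_pM2r// invr_gt0 exprn_gt0.
  rewrite expr_div_n; lra.
have f_low : f (s_at (1 - e')) <= 0.
  have c0 : 0 < 1 - e' by move: e'_lt; lra.
  apply: le_trans scale_high; apply: ler_sum => i _; apply: mpsi2.
  rewrite ler_pM2l// scaleE//.
  have /predsq : norm2 (u (s_at (1 - e')) - thetastar) <= t0.
    apply: u_ball; rewrite ?s_at_gt0 ?(s_at_sqr _ (ltW c0))//; move: e'_lt e'_gt0; lra.
  move=> /(_ i); set a := dotp _ _ => ha.
  have h : (noise i - a) ^+ 2 <= (1 + t0) * noise i ^+ 2 + 2 * t0 * L ^+ 2.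
    rewrite -subr_ge0 -(pmulr_rge0 _ t0_gt0).
    have -> : t0 * ((1 + t0) * noise i ^+ 2 + 2 * t0 * L ^+ 2 - (noise i - a) ^+ 2) =
      (t0 * noise i + a) ^+ 2 + (1 - t0) * a ^+ 2 + 2 * (L ^+ 2 * t0 ^+ 2 - a ^+ 2) by ring.
    apply: addr_ge0; last by rewrite mulr_ge0 ?subr_ge0.
    apply: addr_ge0; first exact: sqr_ge0.
    by apply: mulr_ge0; [move: t0h; lra|exact: sqr_ge0].
  have : (1 - e') * ((noise i - a) ^+ 2 / sigma ^+ 2) <=
     (1 - e') * (((1 + t0) * noise i ^+ 2 + 2 * t0 * L ^+ 2) / sigma ^+ 2).
    by rewrite ler_pM2l// ler_pM2r// invr_gt0 exprn_gt0.
  rewrite expr_div_n; lra.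
have slohi : s_at (1 - e') <= s_at (1 + e').
  rewrite ler_pM2r ?invr_gt0// ler_wsqrtr//; move: e'_gt0; lra.
have [] := IVT (v := 0) slohi (continuous_subspaceT cf).
  rewrite ge_min f_low le_max f_high orbT//.
move=> s; rewrite in_itv /= => /andP[sl sh] fs0.
have c0 : 0 < 1 - e' by move: e'_lt; lra.
have s0 : 0 < s by apply: lt_le_trans sl; exact: s_at_gt0.
have sl2 : 1 - e' <= (sigma * s) ^+ 2.
  rewrite -(s_at_sqr _ (ltW c0)) ler_sqr ?nnegrE; [|by nneg|by nneg].
  by rewrite ler_pM2l.
have c1 : 0 < 1 + e' by rewrite addr_gt0.
have sh2 : (sigma * s) ^+ 2 <= 1 + e'.
  rewrite -(s_at_sqr _ (ltW c1)) ler_sqr ?nnegrE; [|by nneg|by nneg].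
  by rewrite ler_pM2l.
exists (u s), s^-1; split.
- by rewrite invr_gt0.
- transitivity (- ridge_field x (lam0 * a1) (g s) (u s)); last by rewrite hu oppr0.
  rewrite /f1_ridge invrK scaler_sumr /ridge_field opprD -sumrN.
  congr (_ - _); apply: eq_bigr => i _.
  by rewrite /g (gtr0_norm s0) scaleNr opprK scalerA.
- transitivity (n%:R^-1 * f s); last by rewrite fs0 mulr0.
  congr (_ * _); by apply: eq_bigr => i _; rewrite exprVn invrK.
- rewrite -norm2N opprB; apply: u_ball => //; move: e'_lt; lra.
- rewrite exprVn; have s20 : 0 < s ^+ 2 by rewrite exprn_gt0.
  rewrite !ler_pdivlMr// !ler_pdivrMr// -exprMn.
  by split.
Qed.

End Deterministic.

(** * Weighted expectations under independence *)

Section WeightTransfer.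
Context {R : realType} {dT dV : measure_display}.
Context {T : measurableType dT} {V : measurableType dV}.
Variables (P : probability T R) (X : T -> V).
Hypothesis mX : measurable_fun setT X.
Import HBNNSimple.

Let mXB (B : set V) : measurable B -> measurable (X @^-1` B).
Proof. by move=> mB; rewrite -[X @^-1` B]setTI; exact: mX. Qed.

Let weight_nnsfun (Q : T -> R) (h : {nnsfun V >-> R}) :
  measurable_fun setT Q -> (forall w, 0 <= Q w) ->
  (\int[P]_w ((h (X w))%:E * (Q w)%:E) = \sum_(r \in range h)
     (r%:E * \int[P]_(w in X @^-1` (h @^-1` [set r])) (Q w)%:E))%E.
Proof.
move=> mQ Q0; have mE := (measurable_EFinP _ _).2 mQ.
have mB r : measurable (X @^-1` (h @^-1` [set r])).
  by apply: mXB; rewrite -[h @^-1` _]setTI; exact: measurable_funP.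
transitivity (\int[P]_w (\sum_(r \in range h)
    (r%:E * ((Q w)%:E * (\1_(X @^-1` (h @^-1` [set r])) w)%:E))))%E.
  apply: eq_integral => w _.
  rewrite fimfunE -fsumEFin//= ge0_mule_fsuml => [|r]; last first.
    exact: nnfun_muleindic_ge0.
  by apply: eq_fsbigr => r _; rewrite EFinM -muleA (muleC (Q w)%:E).
have mI r : measurable_fun setT
    (fun w => (Q w)%:E * (\1_(X @^-1` (h @^-1` [set r])) w)%:E)%E.
  apply: emeasurable_funM => //; apply/measurable_EFinP.
  exact: measurable_indic.
have I0 r w : (0 <= (Q w)%:E * (\1_(X @^-1` (h @^-1` [set r])) w)%:E)%E.
  by rewrite mule_ge0 ?lee_fin.
rewrite ge0_integral_fsum//; last 2 first.
- move=> r; apply: emeasurable_funM => //; exact: measurable_cst.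
- move=> r w _; rewrite (muleC (Q w)%:E) muleA mule_ge0 ?lee_fin//.
  exact: (nnfun_muleindic_ge0 h r (X w)).
apply: eq_fsbigr => r; rewrite inE => -[v _ <-].
rewrite ge0_integralZl_EFin//; congr (_ * _)%E.
by rewrite [RHS]integral_mkcond epatch_indic.
Qed.

(** Two weights with the same mass on every event of the form [X \in B] cannot
    be told apart by integrating functions of [X]. This one transfer principle
    gives both the factorisation of expectations under independence and the
    pulling of [X]-measurable factors out of a conditional expectation. *)
Lemma eq_weighted_integral (Q1 Q2 : T -> R) (f : V -> R) :
  measurable_fun setT Q1 -> measurable_fun setT Q2 ->
  (forall w, 0 <= Q1 w) -> (forall w, 0 <= Q2 w) ->
  measurable_fun setT f -> (forall v, 0 <= f v) ->
  (forall B, measurable B -> (\int[P]_(w in X @^-1` B) (Q1 w)%:E =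
                             \int[P]_(w in X @^-1` B) (Q2 w)%:E)%E) ->
  (\int[P]_w (f (X w) * Q1 w)%:E = \int[P]_w (f (X w) * Q2 w)%:E)%E.
Proof.
move=> mQ1 mQ2 Q10 Q20 mf f0 Q12.
have mEf : measurable_fun setT (EFin \o f) by exact/measurable_EFinP.
pose h := nnsfun_approx measurableT mEf.
have lim_int (Q : T -> R) : measurable_fun setT Q -> (forall w, 0 <= Q w) ->
    (\int[P]_w (f (X w) * Q w)%:E =
     limn (fun k => \int[P]_w ((h k (X w))%:E * (Q w)%:E)))%E.
  move=> mQ Q0; rewrite -monotone_convergence//.
  - apply: eq_integral => w _; apply/esym/cvg_lim => //; rewrite EFinM.
    apply: cvgeZr => //; apply: (cvg_nnsfun_approx measurableT mEf) => //.
    by move=> v _; rewrite lee_fin.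
  - move=> k; apply: emeasurable_funM; apply/measurable_EFinP => //.
    by apply: measurableT_comp mX; exact: measurable_funP.
  - by move=> k w _; rewrite mule_ge0 ?lee_fin.
  - move=> w _ a b ab; apply: lee_wpmul2r; first by rewrite lee_fin.
    by rewrite lee_fin; exact/lefP/nd_nnsfun_approx.
rewrite !lim_int//; congr (limn _); apply/funext => k.
rewrite !weight_nnsfun//; apply: eq_fsbigr => r _; congr (_ * _)%E.
by apply: Q12; rewrite -[_ @^-1` _]setTI; exact: measurable_funP.
Qed.

End WeightTransfer.

Section IndependentProducts.
Context {R : realType} {dT dV : measure_display}.
Context {T : measurableType dT} {V : measurableType dV}.
Variables (P : probability T R) (n : nat) (z : 'I_n -> T -> V).
Hypothesis mz : forall i, measurable_fun setT (z i).
Hypothesis indep : forall B : 'I_n -> set V, (forall i, measurable (B i)) ->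
  P [set w | forall i, B i (z i w)] = (\prod_(i < n) P (z i @^-1` B i))%E.

Let mzB i (B : set V) : measurable B -> measurable (z i @^-1` B).
Proof. by move=> mB; rewrite -[z i @^-1` B]setTI; exact: mz. Qed.

Let integral_indic_comp i (B : set V) : measurable B ->
  (\int[P]_w (\1_B (z i w))%:E = P (z i @^-1` B))%E.
Proof.
move=> mB; transitivity (\int[P]_w (\1_(z i @^-1` B) w)%:E)%E; first by [].
by rewrite integral_indic ?setIT//; exact: mzB.
Qed.

Let prod_EFin (c : 'I_n -> R) :
  (\prod_(i < n) (c i)%:E = (\prod_(i < n) c i)%:E)%E.
Proof. by elim/big_rec2 : _ => // i a b _ ->. Qed.

Let measurable_factors (f : 'I_n -> V -> R) (Q : pred 'I_n) :
  (forall i, measurable_fun setT (f i)) ->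
  measurable_fun setT (fun w => \prod_(i < n | Q i) f i (z i w)).
Proof.
move=> mf; under eq_fun do rewrite big_mkcond.
apply: measurable_prod => i _; case: (Q i) => //.
exact: measurableT_comp (mf i) (mz i).
Qed.

Let expectation_prod_indic k (f : 'I_n -> V -> R) (c : 'I_n -> R) :
  (forall i, measurable_fun setT (f i)) -> (forall i v, 0 <= f i v) ->
  (forall i, (\int[P]_w (f i (z i w))%:E = (c i)%:E)%E) ->
  (forall i : 'I_n, (k <= i)%N -> exists2 B, measurable B & f i = \1_B) ->
  (\int[P]_w (\prod_(i < n) f i (z i w))%:E = (\prod_(i < n) c i)%:E)%E.
Proof.
elim: k f c => [|k IH] f c mf f0 fc find.
  have /choice[B hB] : forall i, exists B, measurable B /\ f i = \1_B.
    by move=> i; have [B mB fB] := find i (leq0n _); exists B.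
  have mB i := (hB i).1.
  have mA : measurable [set w | forall i, B i (z i w)].
    rewrite (_ : mkset _ = \bigcap_(i in [set: 'I_n]) (z i @^-1` B i)); last first.
      by apply/seteqP; split => w /= h i => [_|]; exact: h.
    by apply: fin_bigcap_measurable => // i _; exact: mzB.
  transitivity (\int[P]_w (\1_([set w | forall i, B i (z i w)]) w)%:E)%E.
    apply: eq_integral => w _; congr (_%:E); rewrite indicE.
    have [h|h] := pselect (forall i, B i (z i w)).
      rewrite mem_set// big1// => i _; rewrite (hB i).2 indicE mem_set//; exact: h.
    rewrite memNset//; move/existsNP : h => [i hi].
    by rewrite (bigD1 i)//= (hB i).2 indicE memNset// mul0r.
  rewrite integral_indic// setIT -prod_EFin; apply: (eq_trans (indep mB)).
  apply: eq_bigr => i _.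
  by rewrite -fc (hB i).2 integral_indic_comp.
have [kn|nk] := ltnP k n; last first.
  by apply: IH => // i ki; have := ltn_ord i; rewrite ltnNge (leq_trans nk ki).
pose i0 := Ordinal kn.
pose Q w := \prod_(i < n | i != i0) f i (z i w).
pose q := \prod_(i < n | i != i0) c i.
have mQ : measurable_fun setT Q by exact: measurable_factors.
have Q0 w : 0 <= Q w by apply: prodr_ge0.
have c0 i : 0 <= c i.
  by rewrite -lee_fin -fc; apply: integral_ge0 => w _; rewrite lee_fin.
have q0 : 0 <= q by apply: prodr_ge0.
have -> : (\int[P]_w (\prod_(i < n) f i (z i w))%:E =
    \int[P]_w (f i0 (z i0 w) * Q w)%:E)%E.
  by apply: eq_integral => w _; rewrite (bigD1 i0).
rewrite (@eq_weighted_integral _ _ _ _ _ P (z i0) (mz i0) Q (cst q) (f i0))//.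
- under eq_integral do rewrite mulrC EFinM.
  rewrite ge0_integralZl_EFin//.
  + by rewrite fc -EFinM (bigD1 i0)//= mulrC.
  + by move=> w _; rewrite lee_fin.
  + by apply/measurable_EFinP; exact: measurableT_comp (mf i0) (mz i0).
- move=> B mB.
  (* On the event that the new variable lies in [B] the other factors integrate
     to a constant times the probability, by the induction hypothesis. *)
  pose f' i := if i == i0 then \1_B else f i.
  pose c' i := if i == i0 then fine (P (z i0 @^-1` B)) else c i.
  have := IH f' c' _ _ _ _; rewrite /f' /c'.
  rewrite (bigD1 i0)//= eqxx (eq_bigr c) => [h|i /negbTE->//].
  transitivity (q%:E * P (z i0 @^-1` B))%E; last first.
    by apply/esym/integral_cst; exact: mzB.
  rewrite muleC -[X in (X * _)%E]fineK ?fin_num_measure//; last exact: mzB.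
  rewrite -EFinM -h.
  + rewrite integral_mkcond epatch_indic; apply: eq_integral => w _ /=.
    rewrite (bigD1 i0)//= eqxx -EFinM mulrC; congr (_ * _)%:E.
    by apply: eq_bigr => i /negbTE->.
  + by move=> i; case: ifP => // _; exact: measurable_indic.
  + by move=> i v; case: ifP.
  + move=> i; case: ifP => // /eqP ->.
    rewrite fineK ?fin_num_measure//; last exact: mzB.
    exact: integral_indic_comp.
  + move=> i ki; case: ifP => [_|ii]; first by exists B.
    apply: find; rewrite ltn_neqAle ki andbT; apply: contraFneq ii => ki0.
    by apply/eqP/val_inj.
Qed.

(** Starting from indicators, for which this is the definition of independence,
    one factor at a time is replaced by an arbitrary function. *)
Lemma expectation_prod (f : 'I_n -> V -> R) (c : 'I_n -> R) :
  (forall i, measurable_fun setT (f i)) -> (forall i v, 0 <= f i v) ->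
  (forall i, (\int[P]_w (f i (z i w))%:E = (c i)%:E)%E) ->
  (\int[P]_w (\prod_(i < n) f i (z i w))%:E = (\prod_(i < n) c i)%:E)%E.
Proof.
move=> mf f0 fc; apply: (@expectation_prod_indic n) => // i.
by rewrite leqNgt ltn_ord.
Qed.

End IndependentProducts.

Section ConditionalChernoff.
Context {R : realType} {dT dV : measure_display}.
Context {T : measurableType dT} {V : measurableType dV} {U : ptopologicalType}.
Variables (P : probability T R) (n : nat) (z : 'I_n -> T -> V) (proj : V -> U).
Hypothesis mz : forall i, measurable_fun setT (z i).
Hypothesis indep : forall B : 'I_n -> set V, (forall i, measurable (B i)) ->
  P [set w | forall i, B i (z i w)] = (\prod_(i < n) P (z i @^-1` B i))%E.
Hypothesis mproj : forall B, borel U B -> measurable (proj @^-1` B).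

Let x i w := proj (z i w).

Let borelT : borel U setT.
Proof. by rewrite -setC0 -setTD; case: (smallest_sigma_algebra setT [set A : set U | open A]) => s0 sC _; apply: sC. Qed.

Let borelI A B : borel U A -> borel U B -> borel U (A `&` B).
Proof.
move=> bA bB; pose S := g_sigma_algebraType [set A : set U | open A].
exact: (@measurableI _ S).
Qed.

Let mxB i B : borel U B -> measurable (x i @^-1` B).
Proof.
by move=> bB; have := mz i measurableT (mproj bB); rewrite setTI.
Qed.

Let rectangles := [set A : set T | exists2 B : 'I_n -> set U,
  forall i, borel U (B i) & A = [set w | forall i, B i (x i w)]].

Let measurable_rectangle A : rectangles A -> measurable A.
Proof.
move=> [B mB ->].
rewrite (_ : mkset _ = \bigcap_(i in [set: 'I_n]) (x i @^-1` B i)); last first.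
  by apply/seteqP; split => w /= h i => [_|]; exact: h.
by apply: fin_bigcap_measurable => // i _; exact: mxB.
Qed.

Let sigma_family_rectangles A : sigma_family x A -> <<s rectangles >> A.
Proof.
apply: smallest_sub; first exact: smallest_sigma_algebra.
move=> _ [i _ [B bB <-]]; apply: sub_sigma_algebra.
exists (fun j => if j == i then B else setT).
  by move=> j; case: ifP.
rewrite setTI; apply/seteqP; split => w /=; last by move/(_ i); rewrite eqxx.
by move=> h j; case: eqP => // ->.
Qed.

Lemma measurable_sigma_family A : sigma_family x A -> measurable A.
Proof.
move/sigma_family_rectangles; apply: smallest_sub; last exact: measurable_rectangle.
exact: sigma_algebra_measurable.
Qed.

Variables (wt : V -> R) (c : R).
Hypotheses (mwt : measurable_fun setT wt) (wt0 : forall v, 0 <= wt v).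
Hypothesis cond_mean : forall i B, borel U B ->
  (\int[P]_(w in x i @^-1` B) (wt (z i w))%:E = c%:E * P (x i @^-1` B))%E.

Let W w := \prod_(i < n) wt (z i w).

Let mW : measurable_fun setT W.
Proof. by apply: measurable_prod => i _; exact: measurableT_comp mwt (mz i). Qed.

Let mEW (A : set T) : measurable_fun A (EFin \o W).
Proof. by apply/measurable_EFinP; exact: measurable_funTS. Qed.

Let W0 w : 0 <= W w. Proof. by apply: prodr_ge0. Qed.

(** Independence gives the identity on rectangles, where the event factors along
    with the weights; the pi-lambda theorem extends it to the generated
    sigma-algebra. It is an equality because inequalities would not pass to
    complements. *)
Lemma cond_expectation_prod A : sigma_family x A ->
  (\int[P]_(w in A) (W w)%:E = (c ^+ n)%:E * P A)%E.
Proof.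
pose D := [set A : set T | measurable A /\
  (\int[P]_(w in A) (W w)%:E = (c ^+ n)%:E * P A)%E].
suff DG : <<s rectangles >> `<=` D.
  by move=> /sigma_family_rectangles/DG[].
have RD : rectangles `<=` D.
  move=> A' RA; split; first exact: measurable_rectangle.
  case: RA => B bB AE.
  pose f i v := wt v * \1_(proj @^-1` B i) v.
  pose cc i := c * fine (P (x i @^-1` B i)).
  have mf i : measurable_fun setT (f i).
    by apply: measurable_funM => //; apply: measurable_indic; exact: mproj.
  have f0 i v : 0 <= f i v by rewrite mulr_ge0.
  have fc i : (\int[P]_w (f i (z i w))%:E = (cc i)%:E)%E.
    rewrite /cc EFinM fineK ?fin_num_measure//; last exact: mxB.
    rewrite -cond_mean// [RHS]integral_mkcond epatch_indic.
    by apply: eq_integral => w _; rewrite /= -EFinM.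
  have := expectation_prod mz indep mf f0 fc.
  rewrite big_split /= prodr_const card_ord => h.
  transitivity (\int[P]_w (\prod_(i < n) f i (z i w))%:E)%E.
    rewrite [LHS]integral_mkcond epatch_indic; apply: eq_integral => w _ /=.
    rewrite -EFinM big_split /=; congr (_ * _)%:E; rewrite indicE AE.
    have [hw|hw] := pselect (forall i, B i (x i w)).
      by rewrite mem_set// big1// => i _; rewrite indicE mem_set//; exact: hw.
    rewrite memNset//; move/existsNP : hw => [i hi].
    by rewrite (bigD1 i)//= indicE memNset// mul0r.
  rewrite h EFinM; congr (_ * _)%E; rewrite AE.
  rewrite (indep (B := fun i => proj @^-1` B i)); last by move=> i; exact: mproj.
  elim/big_rec2 : _ => // i a b _ <-.
  by rewrite EFinM fineK// fin_num_measure//; exact: mxB.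
rewrite -setI_closed_g_dynkin_g_sigma_algebra; last first.
  move=> _ _ [A' bA ->] [B bB ->]; exists (fun i => A' i `&` B i).
    by move=> i; exact: borelI.
  apply/seteqP; split => w /=; first by move=> [hA hB] i; split.
  by move=> h; split => i; case: (h i).
apply: smallest_sub => //; split.
- apply: RD; exists (fun=> setT) => //.
  by apply/seteqP; split.
- move=> B [mB BE]; split; first exact: measurableC.
  have DT : D setT.
    by apply: RD; exists (fun=> setT) => //; apply/seteqP; split.
  have mC := measurableC mB.
  have := DT.2; rewrite -(setvU B) (ge0_integral_setU P mC mB)//; first last.
    by apply/disj_setPCr.
    by move=> w _; rewrite lee_fin.
  rewrite measureU//; last by rewrite setICl.
  rewrite BE ge0_muleDr// => /(congr1 (fun t => t - (c ^+ n)%:E * P B))%E.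
  have kfin : ((c ^+ n)%:E * P B)%E \is a fin_num.
    by rewrite fin_numM// fin_num_measure.
  by rewrite !addeK.
- move=> F tF DF; have mF k : measurable (F k) by case: (DF k).
  split; first exact: bigcup_measurable.
  rewrite ge0_integral_bigcup//; last by move=> w _; rewrite lee_fin.
  rewrite measure_bigcup//.
  rewrite (eq_eseriesr (fun k _ => (DF k).2)).
  rewrite nneseriesZl//; congr (_ * _)%E; apply: eq_eseriesl => k; by rewrite in_setT.
Qed.

(** Exponential Markov inequality given the design. The bound multiplies [P A]
    for every design event [A], which is the form of a conditional tail bound. *)
Lemma cond_chernoff (A F : set T) (p kappa : R) :
  sigma_family x A -> measurable F -> 0 < kappa ->
  c ^+ n <= p * kappa -> (forall w, A w -> F w -> kappa <= W w) ->
  (P (A `&` F) <= p%:E * P A)%E.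
Proof.
move=> sA mF k0 ck kW; have mA := measurable_sigma_family sA.
have mAF : measurable (A `&` F) by exact: measurableI.
have h : (kappa%:E * P (A `&` F) <= (c ^+ n)%:E * P A)%E.
  rewrite -cond_expectation_prod//.
  apply: (@le_trans _ _ (\int[P]_(w in A `&` F) (W w)%:E)%E); last first.
    by apply: ge0_subset_integral => // w _; rewrite lee_fin.
  rewrite -integral_cst//; apply: ge0_le_integral => //.
  - by move=> w _; rewrite lee_fin ltW.
  - by move=> w [Aw Fw]; rewrite lee_fin kW.
have : (kappa%:E * P (A `&` F) <= kappa%:E * (p%:E * P A))%E.
  apply: (le_trans h); rewrite muleA -EFinM [kappa * p]mulrC.
  by apply: lee_wpmul2r => //; rewrite lee_fin.
by rewrite lee_pmul2l.
Qed.

End ConditionalChernoff.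

(** * Conditional tail bounds *)

(* Lets pairs of a response and a covariate form a pointed topological space, as
   the Borel sigma-algebra on them requires. *)
HB.saturate prod.

Section Borel.

Lemma borel_continuous (U V : topologicalType) (f : U -> V) (B : set V) :
  continuous f -> borel V B -> borel U (f @^-1` B).
Proof.
move=> cf; suff h : borel V `<=` [set B | borel U (f @^-1` B)] by exact: h.
have [s0 sC sU] := smallest_sigma_algebra setT [set A : set U | open A].
apply: smallest_sub => [|A oA]; last first.
  apply: sub_sigma_algebra => /=; apply: open_comp => // u _; exact: cf.
split => /=.
- by rewrite preimage_set0.
- by move=> A; rewrite setTD preimage_setC -setTD; exact: sC.
- by move=> F; rewrite preimage_bigcup; exact: sU.
Qed.

Lemma measurable_fun_borel_continuous (R : realType) (U : ptopologicalType)
    (f : g_sigma_algebraType [set A : set U | open A] -> R) :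
  continuous (f : U -> R) -> measurable_fun setT f.
Proof.
move=> cf; apply: (measurability _ (RGenOInfty.measurableE R)).
move=> _ [_ [r ->] <-]; rewrite setTI; apply: sub_sigma_algebra => /=.
apply: open_comp; first by move=> u _; exact: cf.
exact: interval_open.
Qed.

Lemma borel_measurable_fun (disp : measure_display) (T : measurableType disp)
    (U : ptopologicalType)
    (X : T -> g_sigma_algebraType [set A : set U | open A]) :
  borel_measurable (X : T -> U) -> measurable_fun setT X.
Proof. by move=> mX _ B mB; rewrite setTI; exact: mX. Qed.

End Borel.

(** The conditional probability of [F] given the sigma-algebra [S] is at most
    [p], tested on the events of [S]. *)
Definition cond_prob_le {R : realType} {disp : measure_display}
    {T : measurableType disp} (P : probability T R) (S : set (set T)) (F : set T)
    (p : R) : Prop :=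
  measurable F /\ forall A, S A -> (P (A `&` F) <= p%:E * P A)%E.

Section ConditionalTails.
Context {R : realType} {disp : measure_display} {T : measurableType disp}.
Variables (P : probability T R) (d n : nat).
Variables (x : 'I_n -> T -> 'cV[R]_d) (y noise : 'I_n -> T -> R).
Variables (thetastar : 'cV[R]_d) (beta sigma m : R).
Hypothesis hmodel : forall i w, y i w = dotp (x i w) thetastar + noise i w.
Hypothesis hdata : iid P (fun i w => (y i w, x i w)).
Hypothesis hmean : forall i, is_cond_exp P (x i) (noise i) (cst 0).
Hypothesis hvar : forall i,
  is_cond_exp P (x i) (fun w => noise i w ^+ 2) (cst (sigma ^+ 2)).
Hypothesis hmom : forall i,
  is_cond_exp P (x i) (fun w => `|noise i w| `^ (2 * beta)) (cst m).

Let U := ('cV[R]_d : ptopologicalType).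
Let V0 := ((R * 'cV[R]_d)%type : ptopologicalType).
Let V := g_sigma_algebraType [set A : set V0 | open A].
Let VX := g_sigma_algebraType [set A : set U | open A].

Let z (i : 'I_n) (w : T) : V := (y i w, x i w).
Let proj (v : V) : U := v.2.
Let res (v : V) : R := v.1 - dotp v.2 thetastar.

Let res_z i w : res (z i w) = noise i w.
Proof. by rewrite /res /z /= hmodel addrC addKr. Qed.

Let mz i : measurable_fun setT (z i).
Proof. by have [mzx _ _] := hdata; apply: borel_measurable_fun; exact: (mzx i). Qed.

Let mproj B : borel U B -> measurable (proj @^-1` B).
Proof. by apply: borel_continuous => v; exact: cvg_snd. Qed.

Let mX i : measurable_fun setT (x i : T -> VX).
Proof.
apply: borel_measurable_fun => B bB.
by have := mz i measurableT (mproj bB); rewrite setTI.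
Qed.

Let indep (B : 'I_n -> set V) : (forall i, measurable (B i)) ->
  P [set w | forall i, B i (z i w)] = (\prod_(i < n) P (z i @^-1` B i))%E.
Proof.
move=> mB; have [_ ind _] := hdata; have := ind [set: 'I_n]%SET B mB.
rewrite (eq_bigl predT) => [<-|i]; last by rewrite inE.
congr (P _); apply/seteqP; split => w /=; first by move=> h i _; exact: h.
by move=> h i; apply: h => /=; rewrite inE.
Qed.

Let coord_measurable (j : 'I_d) : measurable_fun setT (fun u : VX => (u : 'cV[R]_d) j 0).
Proof. by apply: measurable_fun_borel_continuous; exact: coord_continuous. Qed.

Let mproj_fun : measurable_fun setT (proj : V -> VX).
Proof. by move=> _ B mB; rewrite setTI; exact: mproj. Qed.

Let mres : measurable_fun setT res.
Proof.
apply: measurable_funB.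
  apply: (@measurable_fun_borel_continuous _ V0 fst) => v; exact: cvg_fst.
apply: measurable_sum => j; apply: measurable_funM => //.
exact: measurableT_comp (coord_measurable j) mproj_fun.
Qed.

Let mnoise i : measurable_fun setT (noise i).
Proof.
rewrite (_ : noise i = res \o z i); first exact: measurableT_comp mres (mz i).
by apply/funext => w /=; rewrite res_z.
Qed.

Lemma measurable_design_event A : sigma_family x A -> measurable A.
Proof. exact: (measurable_sigma_family mz mproj). Qed.

Lemma cond_moment i (a0 b1 b2 b3 : R) (B : set U) : borel U B ->
  (\int[P]_(w in x i @^-1` B) (a0 + b1 * noise i w + b2 * noise i w ^+ 2 +
      b3 * `|noise i w| `^ (2 * beta))%:E =
   (a0 + b2 * sigma ^+ 2 + b3 * m)%:E * P (x i @^-1` B))%E.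
Proof.
move=> bB; set A := x i @^-1` B.
have mA : measurable A by have := mX i measurableT bB; rewrite setTI.
have sA : sigma_of (x i) A by exists B => //; rewrite setTI.
have [i1 _ _ /(_ _ sA) e1] := hmean i.
have [i2 _ _ /(_ _ sA) e2] := hvar i.
have [i3 _ _ /(_ _ sA) e3] := hmom i.
have sub (f : T -> R) : P.-integrable setT (EFin \o f) -> P.-integrable A (EFin \o f).
  by apply: integrableS.
have j1 := integrableZl mA b1 (sub _ i1).
have j2 := integrableZl mA b2 (sub _ i2).
have j3 := integrableZl mA b3 (sub _ i3).
have j0 : P.-integrable A (EFin \o cst a0) by exact: finite_measure_integrable_cst.
under eq_integral do rewrite !EFinD !EFinM.
rewrite (integralD mA (integrableD mA (integrableD mA j0 j1) j2) j3).
rewrite (integralD mA (integrableD mA j0 j1) j2) (integralD mA j0 j1).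
rewrite (integralZl mA (sub _ i1)) (integralZl mA (sub _ i2)) (integralZl mA (sub _ i3)).
have ic r : (\int[P]_(w in A) (cst r w)%:E = r%:E * P A)%E.
  by rewrite -(integral_cst P mA r%:E).
rewrite e1 e2 e3 !ic mul0e mule0 adde0.
have [p pE] : exists p : R, P A = p%:E.
  by exists (fine (P A)); rewrite fineK// fin_num_measure.
rewrite pE -!(EFinM, EFinD); congr EFin; ring.
Qed.

Hypothesis n0 : (0 < n)%N.

(** The weight replaces the exponential of the summand in the Laplace transform,
    because its conditional mean is known exactly. *)
Let weight_tail (wt h : V -> R) (c g tau p : R) :
  measurable_fun setT wt -> measurable_fun setT h ->
  (forall v, expR (h v) <= wt v) ->
  (forall i B, borel U B ->
    (\int[P]_(w in x i @^-1` B) (wt (z i w))%:E = c%:E * P (x i @^-1` B))%E) ->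
  c <= expR g -> expR (n%:R * g - tau) <= p ->
  cond_prob_le P (sigma_family x) [set w | tau < \sum_(i < n) h (z i w)] p.
Proof.
move=> mwt mh hwt cwt cg gp.
have wt0 v : 0 <= wt v by rewrite (le_trans _ (hwt v))// expR_ge0.
have mF : measurable [set w | tau < \sum_(i < n) h (z i w)].
  rewrite (_ : mkset _ = (fun w => \sum_(i < n) h (z i w)) @^-1` `]tau, +oo[).
    rewrite -[_ @^-1` _]setTI; apply: measurable_sum => // i.
    exact: measurableT_comp mh (mz i).
  by apply/seteqP; split => w /=; rewrite in_itv /= andbT.
split => // A sA.
have c0 : 0 <= c.
  have := cwt (Ordinal n0) setT; rewrite preimage_setT probability_setT mule1.
  move=> /(_ _) h0; rewrite -lee_fin -h0; last first.
    by rewrite -setC0 -setTD; case: (smallest_sigma_algebra setT [set A : set U | open A]) => s0 sC _; apply: sC.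
  by apply: integral_ge0 => w _; rewrite lee_fin.
apply: (@cond_chernoff _ _ _ _ _ U P n z proj mz indep mproj wt c mwt wt0 cwt
  A _ p (expR tau) sA mF (expR_gt0 _)).
- apply: le_trans (ler_wpM2r (expR_ge0 _) gp); rewrite -expRD subrK expRM_natl.
  by apply: lerXn2r; rewrite ?nnegrE// expR_ge0.
- move=> w _ Fw; apply: (@le_trans _ _ (\prod_(i < n) expR (h (z i w)))).
    by rewrite -expR_sum ler_expR ltW.
  by apply: ler_prod => i _; rewrite expR_ge0 hwt.
Qed.

(** A bounded factor depending only on the covariate is absorbed by writing the
    weight as a mixture, with covariate-dependent proportions, of two
    non-negative quadratics in the noise that have the same conditional mean. *)
Let quadratic_weight_mean (u : VX -> R) (t : R) i (B : set U) :
  measurable_fun setT u -> (forall v, `|u v| <= 1) -> borel U B ->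
  (\int[P]_(w in x i @^-1` B)
      (1 + u (x i w) * (t * noise i w) + (t * noise i w) ^+ 2 / 2)%:E =
   (1 + (t * sigma) ^+ 2 / 2)%:E * P (x i @^-1` B))%E.
Proof.
move=> mu u1 bB; pose Q (s : R) w := 1 + s * (t * noise i w) + (t * noise i w) ^+ 2 / 2.
have mQ s : measurable_fun setT (Q s).
  have mtn : measurable_fun setT (fun w => t * noise i w) by exact: measurable_funM.
  apply: measurable_funD; first by apply: measurable_funD => //; exact: measurable_funM.
  by apply: measurable_funM => //; exact: measurable_funX.
pose c := 1 + (t * sigma) ^+ 2 / 2.
have c0 : 0 <= c by rewrite addr_ge0// mulr_ge0// sqr_ge0.
have Q0 s w : s ^+ 2 = 1 -> 0 <= Q s w.
  move=> s2; rewrite /Q; set r := t * noise i w.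
  have : 0 <= (s * r + 1) ^+ 2 by exact: sqr_ge0.
  by rewrite sqrrD exprMn s2; lra.
have meanQ s A : s ^+ 2 = 1 -> borel U A ->
    (\int[P]_(w in x i @^-1` A) (Q s w)%:E = \int[P]_(w in x i @^-1` A) (cst c w)%:E)%E.
  move=> s2 bA; have mA : measurable (x i @^-1` A).
    by have := mX i measurableT bA; rewrite setTI.
  transitivity (c%:E * P (x i @^-1` A))%E; last by rewrite -(integral_cst P mA c%:E).
  have := cond_moment i 1 (s * t) (t ^+ 2 / 2) 0 bA.
  rewrite (_ : 1 + _ + 0 * m = c); last by rewrite /c; ring.
  by move=> <-; apply: eq_integral => w _; congr (_%:E); rewrite /Q; ring.
have mA : measurable (x i @^-1` B).
  by have := mX i measurableT bB; rewrite setTI.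
have mB1 : measurable_fun setT (\1_B : VX -> R) by exact: measurable_indic.
pose f (s : R) (v : VX) := \1_B v * ((1 + s * u v) / 2).
have mf s : measurable_fun setT (f s).
  apply: measurable_funM => //; apply: measurable_funM => //.
  by apply: measurable_funD => //; exact: measurable_funM.
have f0 s v : `|s| <= 1 -> 0 <= f s v.
  move=> s1; rewrite mulr_ge0// mulr_ge0//.
  have : `|s * u v| <= 1 by rewrite normrM mulr_ile1.
  by rewrite ler_norml => /andP[h _]; lra.
have transfer s : s ^+ 2 = 1 -> `|s| <= 1 ->
    (\int[P]_w (f s (x i w) * Q s w)%:E = \int[P]_w (f s (x i w) * c)%:E)%E.
  move=> s2 s1.
  have h := eq_weighted_integral (mX i) (mQ s) (measurable_cst c) (fun w => Q0 s w s2)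
    (fun _ => c0) (mf s) (fun v => f0 s v s1) (fun A mA' => meanQ s A s2 mA').
  exact: h.
have mfx s : measurable_fun setT (fun w => f s (x i w)).
  exact: measurableT_comp (mf s) (mX i).
have s1 : 1 ^+ 2 = 1 :> R by rewrite expr1n.
have s2 : (-1) ^+ 2 = 1 :> R by rewrite sqrrN expr1n.
have n1 : `|1| <= 1 :> R by rewrite normr1.
have n2 : `|-1| <= 1 :> R by rewrite normrN1.
transitivity (\int[P]_w (f 1 (x i w) * Q 1 w)%:E + \int[P]_w (f (-1) (x i w) * Q (-1) w)%:E)%E.
  rewrite -ge0_integralD//; last 4 first.
  - by move=> w _; rewrite lee_fin mulr_ge0 ?f0 ?Q0.
  - by apply/measurable_EFinP; exact: measurable_funM.
  - by move=> w _; rewrite lee_fin mulr_ge0 ?f0 ?Q0.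
  - by apply/measurable_EFinP; exact: measurable_funM.
  rewrite [LHS]integral_mkcond epatch_indic; apply: eq_integral => w _ /=.
  rewrite -EFinM -EFinD; congr (_%:E); rewrite /f /Q.
  by rewrite (_ : \1_(x i @^-1` B) w = \1_B (x i w))//; field.
rewrite !transfer// -ge0_integralD//; last 4 first.
- by move=> w _; rewrite lee_fin mulr_ge0 ?f0.
- by apply/measurable_EFinP; exact: measurable_funM.
- by move=> w _; rewrite lee_fin mulr_ge0 ?f0.
- by apply/measurable_EFinP; exact: measurable_funM.
rewrite -(integral_cst P mA c%:E) [RHS]integral_mkcond epatch_indic.
apply: eq_integral => w _ /=; rewrite -EFinM -EFinD; congr (_%:E); rewrite /f.
by rewrite (_ : \1_(x i @^-1` B) w = \1_B (x i w))//; field.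
Qed.

Hypothesis sigma0 : 0 < sigma.

(** The two-sided quadratic envelope of [psi] turns the weight into a quadratic
    in the noise, so a second moment gives a sub-Gaussian tail. *)
Lemma score_tail (psi : R -> R) (u : VX -> R) (a : R) :
  influence_function 2 psi -> measurable_fun setT u -> (forall v, `|u v| <= 1) ->
  cond_prob_le P (sigma_family x)
    [set w | n%:R * a ^+ 2 < \sum_(i < n) u (x i w) * psi (a * (noise i w / sigma))]
    (expR (- (n%:R * a ^+ 2 / 2))).
Proof.
move=> hpsi mu u1; have [cpsi _ _ _] := hpsi.
pose r (v : V) := a * (res v / sigma).
have mr : measurable_fun setT r.
  by apply: measurable_funM => //; apply: measurable_funM.
have mup : measurable_fun setT (fun v : V => u (proj v)).
  exact: measurableT_comp mu mproj_fun.
have mpr : measurable_fun setT (fun v : V => psi (r v)).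
  by apply: measurableT_comp mr; exact: continuous_measurable_fun.
pose h (v : V) := u (proj v) * psi (r v).
pose wt (v : V) := 1 + u (proj v) * r v + r v ^+ 2 / 2.
have -> : [set w | n%:R * a ^+ 2 < \sum_(i < n) u (x i w) * psi (a * (noise i w / sigma))]
    = [set w | n%:R * a ^+ 2 < \sum_(i < n) h (z i w)].
  apply/funext => w /=; congr (is_true (_ < _)).
  by apply: eq_bigr => i _; rewrite /h /r res_z.
apply: (@weight_tail wt h (1 + a ^+ 2 / 2) (a ^+ 2 / 2)).
- apply: measurable_funD; first by apply: measurable_funD => //; exact: measurable_funM.
  by apply: measurable_funM => //; exact: measurable_funX.
- exact: measurable_funM.
- by move=> v; exact: influence2_expRM_le.
- move=> i B bB; have := quadratic_weight_mean (a / sigma) i mu u1 bB.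
  rewrite (_ : a / sigma * sigma = a); last by field; rewrite gt_eqF.
  move=> <-; apply: eq_integral => w _; congr (_%:E).
  by rewrite /wt /r res_z (mulrAC a) -mulrA.
- exact: expR_ge1Dx.
- by rewrite ler_expR; lra.
Qed.

(** The exponential of the summand is itself a quadratic in the noise. *)
Lemma log_tail (a : R) :
  cond_prob_le P (sigma_family x)
    [set w | 3 / 2 * (n%:R * a ^+ 2) <
       \sum_(i < n) ln (1 + (a * (noise i w / sigma)) ^+ 2)]
    (expR (- (n%:R * a ^+ 2 / 2))).
Proof.
pose r (v : V) := a * (res v / sigma).
have mr : measurable_fun setT r.
  by apply: measurable_funM => //; apply: measurable_funM.
pose wt (v : V) := 1 + r v ^+ 2.
have mwt : measurable_fun setT wt.
  by apply: measurable_funD => //; exact: measurable_funX.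
pose h (v : V) := ln (wt v).
have -> : [set w | 3 / 2 * (n%:R * a ^+ 2) <
      \sum_(i < n) ln (1 + (a * (noise i w / sigma)) ^+ 2)]
    = [set w | 3 / 2 * (n%:R * a ^+ 2) < \sum_(i < n) h (z i w)].
  apply/funext => w /=; congr (is_true (_ < _)).
  by apply: eq_bigr => i _; rewrite /h /wt /r res_z.
apply: (@weight_tail wt h (1 + a ^+ 2) (a ^+ 2)) => //.
- by apply: measurableT_comp mwt; exact: measurable_ln.
- move=> v; rewrite /h lnK// posrE /wt.
  by have := sqr_ge0 (r v); lra.
- move=> i B bB; have := cond_moment i 1 0 ((a / sigma) ^+ 2) 0 bB.
  rewrite (_ : 1 + _ + 0 * m = 1 + a ^+ 2); last by field; rewrite gt_eqF.
  move=> <-; apply: eq_integral => w _; congr (_%:E).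
  by rewrite /wt /r res_z; field; rewrite gt_eqF.
- exact: expR_ge1Dx.
- by rewrite ler_expR; lra.
Qed.

Hypothesis hbeta : 1 < beta /\ beta <= 2.

(** Reduces the moment of an affine function of the squared noise to the moment
   whose conditional mean is given. *)
Let powR_scale_le (a k rho t : R) : 0 < a -> 0 <= k <= 2 -> `|rho| <= 2 ->
  `|a * (k * t ^+ 2 - rho)| `^ beta <= 16 * a `^ beta * (`|t| `^ (2 * beta) + 1).
Proof.
move=> a0 /andP[k0 k2] hr; have [b1 b2] := hbeta.
have b0 : 0 <= beta by lra.
have t2 := sqr_ge0 t.
pose q := Num.max (t ^+ 2) 1.
have q1 : 1 <= q by rewrite le_max lexx orbT.
have tq : t ^+ 2 <= q by rewrite le_max lexx.
have h1 : `|k * t ^+ 2 - rho| <= 4 * q.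
  apply: (le_trans (ler_normB _ _)); rewrite (ger0_norm (mulr_ge0 k0 t2)).
  have : k * t ^+ 2 <= 2 * q by apply: ler_pM.
  lra.
have h2 : q `^ beta <= `|t| `^ (2 * beta) + 1.
  have tb : (t ^+ 2) `^ beta = `|t| `^ (2 * beta) by rewrite powRrM powR_norm2.
  have := powR_ge0 `|t| (2 * beta).
  rewrite /q; case: (leP (t ^+ 2) 1) => _; first by rewrite powR1; lra.
  by rewrite tb; lra.
rewrite normrM (gtr0_norm a0) (powRM _ (ltW a0) (normr_ge0 _)).
have h3 : `|k * t ^+ 2 - rho| `^ beta <= 16 * (`|t| `^ (2 * beta) + 1).
  apply: (@le_trans _ _ ((4 * q) `^ beta)).
    by rewrite ge0_ler_powR// nnegrE// mulr_ge0//; lra.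
  rewrite powRM//; last by lra.
  apply: ler_pM => //; try exact: powR_ge0.
  have -> : 16 = 4 `^ 2 :> R by rewrite powR_mulrn//; ring.
  by apply: ler_powR => //; lra.
rewrite (_ : 16 * _ * _ = a `^ beta * (16 * (`|t| `^ (2 * beta) + 1))); last by ring.
by apply: ler_wpM2l => //; exact: powR_ge0.
Qed.

(** The centring gap [s * (rho - k)] pays for both the moment term and the
    logarithm of the confidence level, which equals [n * a `^ beta]. *)
Lemma scale_tail (psi : R -> R) (a k rho s : R) :
  influence_function beta psi -> 0 < a -> 0 <= k <= 2 -> `|rho| <= 2 -> `|s| = 1 ->
  (16 * (m * sigma^-1 `^ (2 * beta) + 1) + 1) * a `^ (beta - 1) <= s * (rho - k) ->
  cond_prob_le P (sigma_family x)
    [set w | 0 < \sum_(i < n) s * psi (a * (k * (noise i w / sigma) ^+ 2 - rho))]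
    (expR (- (n%:R * a `^ beta))).
Proof.
move=> hpsi a0 hk hrho s1 gap; have [b1 b2] := hbeta.
have [cpsi _ _ _] := hpsi.
pose t (v : V) := res v / sigma.
have mt : measurable_fun setT t by exact: measurable_funM.
pose Z (v : V) := a * (k * t v ^+ 2 - rho).
have mZ : measurable_fun setT Z.
  apply: measurable_funM => //; apply: measurable_funB => //.
  by apply: measurable_funM => //; exact: measurable_funX.
pose h (v : V) := s * psi (Z v).
pose B := 16 * a `^ beta.
pose wt (v : V) := 1 + s * Z v + B * (`|t v| `^ (2 * beta) + 1).
have mwt : measurable_fun setT wt.
  apply: measurable_funD; first by apply: measurable_funD => //; exact: measurable_funM.
  apply: measurable_funM => //; apply: measurable_funD => //.
  apply: (measurableT_comp (measurable_powR _)).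
  by apply: measurableT_comp mt; exact: normr_measurable.
have -> : [set w | 0 < \sum_(i < n) s * psi (a * (k * (noise i w / sigma) ^+ 2 - rho))]
    = [set w | 0 < \sum_(i < n) h (z i w)].
  apply/funext => w /=; congr (is_true (_ < _)).
  by apply: eq_bigr => i _; rewrite /h /Z /t res_z.
pose mm := m * sigma^-1 `^ (2 * beta).
apply: (@weight_tail wt h (1 + s * (a * (k - rho)) + B * (mm + 1))
    (s * (a * (k - rho)) + B * (mm + 1))) => //.
- apply: measurable_funM => //; apply: measurableT_comp mZ.
  exact: continuous_measurable_fun.
- move=> v; have hz : `|Z v| `^ beta / beta <= B * (`|t v| `^ (2 * beta) + 1).
    apply: (le_trans _ (powR_scale_le (t v) a0 hk hrho)).
    by rewrite ler_pdivrMr ?ler_peMr ?powR_ge0//; lra.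
  rewrite /h /wt; move: s1; case: (ger0P s) => [_ ->|_ /eqP].
    rewrite !mul1r; apply: (le_trans (influence_expR_le (Z v) b1 hpsi)); lra.
  rewrite eqr_oppLR => /eqP ->; rewrite !mulN1r.
  apply: (le_trans (influence_expRN_le (Z v) b1 hpsi)); lra.
- move=> i A bA.
  have := cond_moment i (1 - s * a * rho + B) 0 (s * a * k / sigma ^+ 2)
    (B * sigma^-1 `^ (2 * beta)) bA.
  rewrite (_ : _ + _ + _ * m = 1 + s * (a * (k - rho)) + B * (mm + 1)); last first.
    by rewrite /mm; field; rewrite gt_eqF.
  move=> <-; apply: eq_integral => w _; congr (_%:E).
  rewrite /wt /Z /t res_z normrM powRM// (gtr0_norm (_ : 0 < sigma^-1)) ?invr_gt0//.
  by field; rewrite gt_eqF.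
- by rewrite -addrA expR_ge1Dx.
- rewrite subr0 ler_expR -mulrN ler_wpM2l//.
  have aB : a * a `^ (beta - 1) = a `^ beta by rewrite mulr_powRB1 ?ltW//; lra.
  have := ler_wpM2l (ltW a0) gap; rewrite /B -/mm -aB.
  lra.
Qed.

End ConditionalTails.

Section CondProb.
Context {R : realType} {disp : measure_display} {T : measurableType disp}.
Variables (P : probability T R) (S : set (set T)).
Hypothesis mS : forall A, S A -> measurable A.

Lemma cond_prob_leW F p q : p <= q -> cond_prob_le P S F p -> cond_prob_le P S F q.
Proof.
move=> pq [mF hF]; split => // A sA; apply: (le_trans (hF A sA)).
by apply: lee_wpmul2r => //; rewrite lee_fin.
Qed.

Lemma cond_prob_leU F G p q : cond_prob_le P S F p -> cond_prob_le P S G q ->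
  cond_prob_le P S (F `|` G) (p + q).
Proof.
move=> [mF hF] [mG hG]; split => [|A sA]; first exact: measurableU.
have mA := mS sA; rewrite setIUr EFinD.
apply: (@le_trans _ _ (P (A `&` F) + P (A `&` G))%E).
  by apply: measureU2; exact: measurableI.
have [r rE] : exists r : R, P A = r%:E.
  by exists (fine (P A)); rewrite fineK// fin_num_measure.
have := leeD (hF A sA) (hG A sA).
by rewrite rE -!EFinM -!EFinD mulrDl.
Qed.

Lemma cond_prob_le_bigU k (F : 'I_k -> set T) p :
  (forall i, cond_prob_le P S (F i) p) ->
  cond_prob_le P S [set w | exists i, F i w] (k%:R * p).
Proof.
move=> hF; have -> : [set w | exists i, F i w] = \big[setU/set0]_(i < k) F i.
  apply/seteqP; split => w /=.
    by move=> [i Fi]; rewrite (bigD1 i)//=; left.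
  elim/big_rec : _ => // i A _ IH [Fi|/IH//]; by exists i.
rewrite mulr_natl -[k in p *+ k]card_ord -sumr_const.
elim/big_rec2 : _ => [|i q A _ h]; last exact: cond_prob_leU.
by split => // A _; rewrite setI0 measure0 mul0e.
Qed.

Lemma cond_prob_ge_setC (G F : set T) p : cond_prob_le P S F p ->
  cond_prob_ge P S G (~` F) (1 - p).
Proof.
move=> [mF hF] A sA _; have mA := mS sA.
have := hF A sA.
have -> : P A = (P (A `&` F) + P (A `&` ~` F))%E.
  rewrite -measureU; first by rewrite -setIUr setUv setIT.
  - exact: measurableI.
  - by apply: measurableI => //; exact: measurableC.
  - by rewrite setIACA setICr setI0.
have [a aE] : exists r : R, P (A `&` F) = r%:E.
  by exists (fine (P (A `&` F))); rewrite fineK// fin_num_measure//; exact: measurableI.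
have [b bE] : exists r : R, P (A `&` ~` F) = r%:E.
  exists (fine (P (A `&` ~` F))); rewrite fineK// fin_num_measure//.
  by apply: measurableI => //; exact: measurableC.
rewrite aE bE -EFinD -!EFinM !lee_fin; lra.
Qed.

End CondProb.

(** * Constants *)

Section Constants.
Context {R : realType}.

(** Price, in units of [alpha2 `^ (beta - 1)], of the moment of order [2 * beta]
    and of the confidence level in the bound for the scale equation. *)
Definition moment_factor (m sigma beta : R) : R :=
  16 * (`|m| * sigma^-1 `^ (2 * beta) + 1) + 1.

(** The first term pays for the fluctuations of the scale equation, the second
    for replacing the noise by residuals within distance [t0]. Both are doubled
    because only half of the scale error is spent. *)
Definition scale_constant (m sigma beta L : R) : R :=
  2 * moment_factor m sigma beta + 4 * (1 + L ^+ 2 / sigma ^+ 2).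

Definition rate_constant (K c_l sigma t : R) : R :=
  1 + `|150 * (sigma / c_l) * (1 + K * t)|.

Lemma moment_factor_ge1 m sigma beta : 1 <= moment_factor m sigma beta.
Proof.
have : 0 <= `|m| * sigma^-1 `^ (2 * beta) by rewrite mulr_ge0// powR_ge0.
by rewrite /moment_factor; lra.
Qed.

Lemma scale_constant_gt0 m sigma beta L : 0 < scale_constant m sigma beta L.
Proof.
have := moment_factor_ge1 m sigma beta.
have : 0 <= L ^+ 2 / sigma ^+ 2 by nneg.
by rewrite /scale_constant; lra.
Qed.

Variables (m sigma beta c_l L lam0 eps K e2 t0 : R) (d n : nat) (thetastar : 'cV[R]_d).
Hypotheses (d0 : (0 < d)%N) (n0 : (0 < n)%N) (heps : 0 < eps /\ eps < 1 / 6).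
Hypotheses (hbeta : 1 < beta /\ beta <= 2).
Hypotheses (sigma0 : 0 < sigma) (cl0 : 0 < c_l) (lam00 : 0 < lam0) (L0 : 0 < L).
Hypothesis t0E : t0 = theta0 150 n eps sigma c_l L lam0 thetastar.
Hypothesis e2E : e2 =
  scale_error (scale_constant m sigma beta L) (alpha2 n beta eps) beta t0.

Let N0 : 0 < n%:R :> R. Proof. by rewrite ltr0n. Qed.
Let D1 : 1 <= d%:R :> R. Proof. by rewrite ler1n. Qed.

Lemma inv_eps_gt6 : 6 < eps^-1.
Proof.
have [h1 h2] := heps.
by rewrite -(ltr_pM2r h1) mulVf ?gt_eqF//; lra.
Qed.

Lemma ln_inv_eps_gt0 : 0 < ln eps^-1.
Proof. by apply: ln_gt0; have := inv_eps_gt6; lra. Qed.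

Lemma dim_inv_eps_gt1 : 1 < d%:R * eps^-1.
Proof. by have := inv_eps_gt6; have := D1; nra. Qed.

Lemma ln_dim_inv_eps_gt0 : 0 < ln (d%:R * eps^-1).
Proof. exact: ln_gt0 dim_inv_eps_gt1. Qed.

Lemma alpha1_gt0 : 0 < alpha1 d n eps.
Proof.
by rewrite sqrtr_gt0 divr_gt0// mulr_gt0// ln_dim_inv_eps_gt0.
Qed.

Lemma alpha1_confidence :
  expR (- (n%:R * alpha1 d n eps ^+ 2 / 2)) = eps / d%:R.
Proof.
have l0 := ltW ln_dim_inv_eps_gt0.
rewrite sqr_sqrtr; last by rewrite divr_ge0// ?mulr_ge0// ltW.
have -> : n%:R * (2 * ln (d%:R * eps^-1) / n%:R) / 2 = ln (d%:R * eps^-1).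
  by field; rewrite gt_eqF.
have e0 := dim_inv_eps_gt1.
by rewrite expRN lnK ?posrE 1?(lt_trans _ e0)// invf_div.
Qed.

Lemma alpha2_gt0 : 0 < alpha2 n beta eps.
Proof. by rewrite powR_gt0// divr_gt0// ln_inv_eps_gt0. Qed.

Lemma alpha2_confidence : expR (- (n%:R * alpha2 n beta eps `^ beta)) = eps.
Proof.
have [b1 _] := hbeta; have [e0 _] := heps.
rewrite /alpha2 -powRrM mul1r mulVf ?gt_eqF//; last by rewrite (lt_trans _ b1).
rewrite powRr1; last by rewrite divr_ge0// ltW// ln_inv_eps_gt0.
rewrite mulrC divfK ?gt_eqF//.
by rewrite expRN lnK ?posrE ?invr_gt0// invrK.
Qed.

Let den_gt0 : 0 < lam0 + c_l / sigma.
Proof. by rewrite addr_gt0// divr_gt0. Qed.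

Let sq_ln := Num.sqrt (ln (d%:R * eps^-1) / n%:R).

Let sq_ln_gt0 : 0 < sq_ln.
Proof. by rewrite sqrtr_gt0 divr_gt0// ln_dim_inv_eps_gt0. Qed.

Let t0_den : t0 * (lam0 + c_l / sigma) =
  150 * (Num.sqrt d%:R * L * sq_ln + lam0 * norm2 thetastar).
Proof. by rewrite t0E /theta0 -/sq_ln; field; rewrite !gt_eqF//; rewrite addr_gt0// mulr_gt0. Qed.

Lemma theta0_gt0 : 0 < t0.
Proof.
rewrite -(pmulr_lgt0 _ den_gt0) t0_den mulr_gt0// ltr_pwDl//.
  by rewrite !mulr_gt0// sqrtr_gt0 ltr0n.
by rewrite mulr_ge0 ?norm2_ge0// ltW.
Qed.

(** The factor 150 leaves 100 since [alpha1] carries an additional square root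
    of 2, which is below 3/2. *)
Lemma theta0_rate :
  100 * (Num.sqrt d%:R * L * alpha1 d n eps + lam0 * norm2 thetastar)
  <= t0 * (lam0 + c_l / sigma).
Proof.
have ha : alpha1 d n eps <= 3 / 2 * sq_ln.
  have -> : 3 / 2 = Num.sqrt ((3 / 2) ^+ 2) :> R by rewrite sqrtr_sqr ger0_norm.
  rewrite -sqrtrM ?sqr_ge0//; apply: ler_wsqrtr.
  have l0 := ln_dim_inv_eps_gt0.
  rewrite mulrA; apply: ler_wpM2r; first by rewrite invr_ge0 ltW.
  by apply: ler_wpM2r; [exact: ltW|lra].
have dL : 0 <= Num.sqrt d%:R * L by rewrite mulr_ge0// ltW.
have := ler_wpM2l dL ha; rewrite t0_den.
have : 0 <= lam0 * norm2 thetastar by rewrite mulr_ge0 ?norm2_ge0// ltW.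
lra.
Qed.

Lemma theta0_ridge_rate : 0 < K -> lam0 <= K * ridge_rate d n eps L ->
  t0 <= rate_constant K c_l sigma (norm2 thetastar) * ridge_rate d n eps L.
Proof.
move=> K0 hl; have T0 := norm2_ge0 thetastar.
have rE : ridge_rate d n eps L = Num.sqrt d%:R * L * sq_ln.
  by rewrite /ridge_rate -[d%:R * _ / _]mulrA sqrtrM ?ler0n// -/sq_ln; ring.
have r0 : 0 <= ridge_rate d n eps L by rewrite rE; nneg.
have h1 : t0 * (c_l / sigma) <= t0 * (lam0 + c_l / sigma).
  by rewrite ler_pM2l ?theta0_gt0// lerDr ltW.
have h2 : lam0 * norm2 thetastar <= K * ridge_rate d n eps L * norm2 thetastar.
  exact: ler_wpM2r.
have h3 : t0 * (c_l / sigma) <=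
    150 * (1 + K * norm2 thetastar) * ridge_rate d n eps L.
  by move: h1; rewrite t0_den -rE; lra.
have c0 : 0 < c_l / sigma by rewrite divr_gt0.
apply: (@le_trans _ _ (150 * (sigma / c_l) * (1 + K * norm2 thetastar) * ridge_rate d n eps L)).
  rewrite -(ler_pM2r c0); apply: (le_trans h3); rewrite le_eqVlt; apply/orP; left; apply/eqP.
  by field; rewrite !gt_eqF.
apply: ler_wpM2r => //; rewrite /rate_constant.
by have := ler_norm (150 * (sigma / c_l) * (1 + K * norm2 thetastar)); lra.
Qed.

Hypothesis hdef : 0 < 1 - e2.

Let q0 : 0 <= L ^+ 2 / sigma ^+ 2. Proof. by nneg. Qed.

Let a2b_ge0 : 0 <= alpha2 n beta eps `^ (beta - 1).
Proof. exact: powR_ge0. Qed.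

Let t0_ratio : 0 < t0 / (t0 + 1 / 2).
Proof. by have := theta0_gt0 => h; rewrite divr_gt0//; lra. Qed.

(** [e2 < 1] bounds the ratio [t0 / (t0 + 1/2)] by the inverse of a constant that
    is large compared with [L^2 / sigma^2]. *)
Lemma theta0_small : t0 * (1 + L ^+ 2 / sigma ^+ 2) <= 1 / 2.
Proof.
have tp := theta0_gt0.
have C0 := scale_constant_gt0 m sigma beta L.
have h : scale_constant m sigma beta L * (t0 / (t0 + 1 / 2)) <= 1.
  move: hdef; rewrite e2E /scale_error mulrDr.
  have : 0 <= scale_constant m sigma beta L * alpha2 n beta eps `^ (beta - 1).
    by rewrite mulr_ge0// ltW.
  lra.
have tp' : 0 < t0 + 1 / 2 by lra.
move: h; rewrite mulrA ler_pdivrMr// mul1r /scale_constant.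
have := ler_wpM2r (ltW tp) (moment_factor_ge1 m sigma beta).
have := mulr_ge0 (ltW tp) q0; lra.
Qed.

Let t0_le_half : t0 <= 1 / 2.
Proof. by have := mulr_ge0 (ltW theta0_gt0) q0; have := theta0_small; lra. Qed.

Lemma scale_error_gt0 : 0 < e2.
Proof.
by rewrite e2E /scale_error mulr_gt0 ?scale_constant_gt0// ltr_wpDl.
Qed.

Lemma scale_error_ge : moment_factor m sigma beta * alpha2 n beta eps `^ (beta - 1) +
  2 * (t0 * (1 + L ^+ 2 / sigma ^+ 2)) <= e2 / 2.
Proof.
have tp := theta0_gt0.
have tr : t0 <= t0 / (t0 + 1 / 2).
  rewrite ler_pdivlMr; last by lra.
  by rewrite (ler_piMr (ltW tp))//; have := t0_le_half; lra.
have C0 := scale_constant_gt0 m sigma beta L.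
have h1 : scale_constant m sigma beta L * t0 <= scale_constant m sigma beta L * (t0 / (t0 + 1 / 2)).
  by rewrite ler_wpM2l// ltW.
have h2 : 0 <= moment_factor m sigma beta * t0.
  apply: mulr_ge0; last exact: ltW.
  by have := moment_factor_ge1 m sigma beta; lra.
have h3 : 0 <= (1 + L ^+ 2 / sigma ^+ 2) * alpha2 n beta eps `^ (beta - 1).
  by rewrite mulr_ge0// addr_ge0.
move: h1 h2 h3; rewrite e2E /scale_error /scale_constant; lra.
Qed.

End Constants.

(** * The theorem *)

Section Design.
Context {R : realType} {d n : nat} (x : 'I_n -> 'cV[R]_d) (c_l c_u L : R).
Hypotheses (d0 : (0 < d)%N) (cl0 : 0 < c_l).
Hypothesis hx : design_condition c_l c_u L x.

Lemma design_norm2_le i : norm2 (x i) <= L.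
Proof.
by have [h _ _ _ _] := hx; apply: le_trans h; apply: (le_bigmax _ (fun i => norm2 (x i))).
Qed.

Lemma design_gram_form_ge u : c_l * dotp u u <= gram_form x u u.
Proof.
have [_ _ h _ _] := hx; apply: le_trans (lambda_min_le_gram_form x u d0).
by apply: ler_wpM2r => //; exact: dotp_ge0.
Qed.

Lemma design_bound_gt0 : 0 < L.
Proof.
rewrite ltNge; apply/negP => L0; pose e : 'cV[R]_d := const_mx 1.
have e0 : 0 < dotp e e.
  rewrite /dotp (eq_bigr (fun=> 1)) => [|j _]; last by rewrite !mxE mulr1.
  by rewrite sumr_const card_ord ltr0n.
have := design_gram_form_ge e; rewrite /gram_form big1 => [|i _].
  by rewrite mulr0 leNgt mulr_gt0.
have -> : x i = 0.
  apply: norm2_eq0; apply/eqP; rewrite eq_le norm2_ge0 andbT.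
  exact: le_trans (design_norm2_le i) L0.
by rewrite dotpC dotp0r mul0r.
Qed.

End Design.

Section Clip.
Context {R : realType}.

(** Truncation to [-1, 1], written with absolute values so that measurability is
    immediate. It bounds the covariate factor of the score on the whole space and
    does not change it on the design event. *)
Definition clip (r : R) : R := (`|r + 1| - `|r - 1|) / 2.

Lemma clip_id r : `|r| <= 1 -> clip r = r.
Proof.
rewrite ler_norml => /andP[h1 h2]; rewrite /clip ger0_norm; last by lra.
by rewrite ler0_norm; last lra; field.
Qed.

Lemma clip_le1 r : `|clip r| <= 1.
Proof.
rewrite /clip normrM (ger0_norm (_ : 0 <= 2^-1))//.
have := ler_dist_dist (r + 1) (r - 1).
rewrite (_ : r + 1 - (r - 1) = 2); last by ring.
by rewrite (ger0_norm (_ : 0 <= 2))//; lra.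
Qed.

Lemma measurable_clip : measurable_fun setT clip.
Proof.
apply: measurable_funM => //; apply: measurable_funB.
  by apply: measurableT_comp => //; exact: measurable_funD.
by apply: measurableT_comp => //; exact: measurable_funB.
Qed.

End Clip.

Lemma powRN_half (R : realType) (a : R) : 0 <= a -> a `^ (- (1 / 2)) = (Num.sqrt a)^-1.
Proof. by move=> a0; rewrite powRN mul1r powR12_sqrt. Qed.

Theorem theorem2p5 (R : realType) :
  exists (C : R -> R -> R -> R -> R -> R -> R) (C1 : R -> R -> R)
         (C2 : R -> R -> R -> R -> R -> R) (C3 : R -> R -> R -> R -> R -> R),
  [/\ forall m sigma beta c_u L M, 0 < C m sigma beta c_u L M,
      forall c_l L, 0 < C1 c_l L,
      forall m sigma beta c_u L, 0 < C2 m sigma beta c_u L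
    & forall K c_l L sigma t, 0 < C3 K c_l L sigma t] /\
  forall (beta sigma m c_l c_u L M : R)
    (hbeta : 1 < beta /\ beta <= 2) (hsigma : 0 < sigma)
    (hcl : 0 < c_l) (hcu : 0 < c_u) (hM : 0 < M)
    (d n : nat) (hd : (0 < d)%N) (hn : (0 < n)%N)
    (eps : R) (heps : 0 < eps /\ eps < 1 / 6)
    (lam0 : R) (hlam0 : 0 < lam0)
    (psi1 psi2 : R -> R)
    (hpsi1 : influence_function 2 psi1) (hpsi2 : influence_function beta psi2)
    (hreg : regular_influence M psi1)
    (disp : measure_display) (T : measurableType disp) (P : probability T R)
    (x : 'I_n -> T -> 'cV[R]_d) (y noise : 'I_n -> T -> R) (thetastar : 'cV[R]_d)
    (hmodel : forall i w, y i w = dotp (x i w) thetastar + noise i w)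
    (hdata : iid P (fun i w => (y i w, x i w)))
    (hnoise : iid P noise)
    (hmean : forall i, is_cond_exp P (x i) (noise i) (cst 0))
    (hvar : forall i,
       is_cond_exp P (x i) (fun w => noise i w ^+ 2) (cst (sigma ^+ 2)))
    (hmom : forall i,
       is_cond_exp P (x i) (fun w => `|noise i w| `^ (2 * beta)) (cst m)),
  let a1 := alpha1 d n eps in
  let a2 := alpha2 n beta eps in
  let t0 := theta0 (C1 c_l L) n eps sigma c_l L lam0 thetastar in
  let e2 := scale_error (C2 m sigma beta c_u L) a2 beta t0 in
  forall (hsize : C m sigma beta c_u L M * d%:R * (c_l + lam0)^-1 * (ln (eps^-1) + 1) <= n%:R)
    (* the base of the power (1 - e2)^(-1/2) in the upper bound is positive *)
    (hdef : 0 < 1 - e2),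
  exists E : set T,
  [/\ measurable E,
      cond_prob_ge P (sigma_family x)
        [set w | design_condition c_l c_u L (fun i => x i w)] E (1 - 6 * eps)
    & forall w, E w ->
      design_condition c_l c_u L (fun i => x i w) ->
      exists (theta : 'cV[R]_d) (v : R),
      [/\ 0 < v,
          f1_ridge psi1 a1 lam0 (fun i => x i w) (fun i => y i w) theta v = 0
          /\ f2_ridge psi2 a2 (fun i => x i w) (fun i => y i w) theta v = 0,
          norm2 (thetastar - theta) <= t0,
          (1 + e2) `^ (- (1 / 2)) * sigma <= v
          /\ v <= (1 - e2) `^ (- (1 / 2)) * sigma
        & forall K : R, 0 < K -> lam0 <= K * ridge_rate d n eps L ->
          norm2 (thetastar - theta)
            <= C3 K c_l L sigma (norm2 thetastar) * ridge_rate d n eps L]].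
Proof.
exists (fun _ _ _ _ _ _ => 1), (fun _ _ => 150),
  (fun m sigma beta _ L => scale_constant m sigma beta L),
  (fun K c_l _ sigma t => rate_constant K c_l sigma t).
split; first split => //.
- by move=> m sigma beta _ L; exact: scale_constant_gt0.
- by move=> K c_l _ sigma t; rewrite /rate_constant ltr_pwDl.
move=> beta sigma m c_l c_u L M hbeta sigma0 cl0 _ _ d n d0 n0 eps heps lam0 lam00.
move=> psi1 psi2 hpsi1 hpsi2 _ disp T P x y noise thetastar hmodel hdata _.
move=> hmean hvar hmom a1 a2 t0 e2 _ hdef.
have mS A : sigma_family x A -> measurable A.
  exact: (measurable_design_event hdata).
suff [F [hF hE]] : exists F : set T, cond_prob_le P (sigma_family x) F (6 * eps) /\
    forall w, ~ F w -> design_condition c_l c_u L (fun i => x i w) ->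
      exists (theta : 'cV[R]_d) (v : R),
      [/\ 0 < v,
          f1_ridge psi1 a1 lam0 (fun i => x i w) (fun i => y i w) theta v = 0,
          f2_ridge psi2 a2 (fun i => x i w) (fun i => y i w) theta v = 0,
          norm2 (thetastar - theta) <= t0
        & sigma ^+ 2 <= (1 + e2 / 2) * v ^+ 2 /\ (1 - e2 / 2) * v ^+ 2 <= sigma ^+ 2].
  exists (~` F); split.
  - by apply: measurableC; case: hF.
  - exact: cond_prob_ge_setC.
  move=> w Fw hx; have [theta [v [v0 f1 f2 ht [hv1 hv2]]]] := hE w Fw hx.
  have L0 := design_bound_gt0 d0 cl0 hx.
  have e20 : 0 < e2.
    exact: (@scale_error_gt0 _ _ _ _ _ _ _ _ _ _ _ _ _ d0 n0 heps sigma0 cl0 lam00 L0 erefl erefl).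
  exists theta, v; split => //.
  - have v2 : 0 <= v ^+ 2 by exact: sqr_ge0.
    rewrite !powRN_half; [|by lra|by lra]; split.
    + rewrite mulrC ler_pdivrMr ?sqrtr_gt0; last by lra.
      rewrite -(@ler_pXn2r _ 2)// ?nnegrE; [|by nneg|by nneg].
      rewrite exprMn sqr_sqrtr; last by lra.
      apply: (le_trans hv1); rewrite mulrC; apply: ler_wpM2l => //; lra.
    + rewrite mulrC ler_pdivlMr ?sqrtr_gt0//.
      rewrite -(@ler_pXn2r _ 2)// ?nnegrE; [|by nneg|by nneg].
      rewrite exprMn sqr_sqrtr; last by lra.
      apply: le_trans hv2; rewrite mulrC; apply: ler_wpM2r => //; lra.
  - move=> K K0 hK; apply: (le_trans ht).
    exact: (theta0_ridge_rate d0 n0 heps sigma0 cl0 lam00 L0 (erefl t0)).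
have [e0 _] := heps.
(* With [L <= 0] the design event is empty. *)
have [L0|L0] := leP L 0.
  exists set0; split.
    split => // A _; rewrite setI0 measure0; apply: mule_ge0 => //.
    by rewrite lee_fin mulr_ge0// ltW.
  by move=> w _ hx; have := design_bound_gt0 d0 cl0 hx; rewrite ltNge L0.
have a1p : 0 < a1 := alpha1_gt0 d0 n0 heps.
have a2p : 0 < a2 := alpha2_gt0 beta n0 heps.
have t0p : 0 < t0 := theta0_gt0 d0 n0 heps sigma0 cl0 lam00 L0 (erefl t0).
have t0s := theta0_small d0 n0 heps sigma0 cl0 lam00 L0 (erefl t0) (erefl e2) hdef.
have e2p := scale_error_gt0 d0 n0 heps sigma0 cl0 lam00 L0 (erefl t0) (erefl e2).
have e2g := scale_error_ge d0 n0 heps sigma0 cl0 lam00 L0 (erefl t0) (erefl e2) hdef.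
(* Half of [e2] keeps the scale between fixed multiples of [sigma] even when
   [1 - e2] is close to 0. *)
set e' := e2 / 2 in e2g *.
set q := L ^+ 2 / sigma ^+ 2 in t0s e2g.
have q0 : 0 <= q by rewrite /q; nneg.
have e'p : 0 < e' by rewrite /e'; lra.
have e'h : e' <= 1 / 2 by rewrite /e'; lra.
have t0q : 0 <= t0 * q by rewrite mulr_ge0// ltW.
have t0h : t0 <= 1 / 2 by lra.
have gap : (16 * (m * sigma^-1 `^ (2 * beta) + 1) + 1) * a2 `^ (beta - 1) <=
    e' - 2 * (t0 * (1 + q)).
  rewrite lerBrDr; apply: le_trans e2g; rewrite lerD2r; apply: ler_wpM2r.
    exact: powR_ge0.
  rewrite /moment_factor lerD2r ler_pM2l// lerD2r ler_wpM2r ?powR_ge0//.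
  exact: ler_norm.
pose u (s : R) (j : 'I_d) (v : 'cV[R]_d) := s * clip (v j 0 / L).
have mu s j : measurable_fun setT
    (u s j : g_sigma_algebraType [set A : set 'cV[R]_d | open A] -> R).
  apply: measurable_funM => //; apply: (measurableT_comp measurable_clip).
  apply: measurable_funM => //.
  by apply: measurable_fun_borel_continuous; exact: coord_continuous.
have u1 s j v : `|s| = 1 -> `|u s j v| <= 1.
  by move=> s1; rewrite normrM s1 mul1r clip_le1.
pose F1 s := [set w | exists j, n%:R * a1 ^+ 2 <
  \sum_(i < n) u s j (x i w) * psi1 (a1 * (noise i w / sigma))].
have hF1 s : `|s| = 1 -> cond_prob_le P (sigma_family x) (F1 s) eps.
  move=> s1; have -> : eps = d%:R * (eps / d%:R).
    by rewrite mulrCA divff ?mulr1// pnatr_eq0 -lt0n.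
  rewrite -(alpha1_confidence d0 n0 heps); apply: cond_prob_le_bigU => // j.
  apply: (score_tail hmodel hdata hmean hvar hmom n0 sigma0 a1 hpsi1 (mu s j)) => v.
  exact: u1.
pose F2 := [set w | 3 / 2 * (n%:R * a1 ^+ 2) <
  \sum_(i < n) ln (1 + (a1 * (noise i w / sigma)) ^+ 2)].
have hF2 : cond_prob_le P (sigma_family x) F2 eps.
  apply: cond_prob_leW (log_tail hmodel hdata hmean hvar hmom n0 sigma0 a1).
  rewrite alpha1_confidence// ler_pdivrMr ?ltr0n//.
  by rewrite ler_peMr ?ler1n// ltW.
have [_ mono2 _ _] := hpsi2; have [cont2 _ _ _] := hpsi2.
pose F3 k rho s := [set w | 0 <
  \sum_(i < n) s * psi2 (a2 * (k * (noise i w / sigma) ^+ 2 - rho))].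
have hF3 k rho s : 0 <= k <= 2 -> `|rho| <= 2 -> `|s| = 1 ->
    e' - 2 * (t0 * (1 + q)) <= s * (rho - k) ->
    cond_prob_le P (sigma_family x) (F3 k rho s) eps.
  move=> hk hrho s1 hgap.
  rewrite -(alpha2_confidence n0 heps hbeta).
  apply: (scale_tail hmodel hdata hmean hvar hmom n0 sigma0 hbeta hpsi2 a2p hk hrho s1).
  exact: le_trans gap hgap.
have e't0 : e' * t0 <= t0 / 2 by rewrite mulrC ler_wpM2l ?(ltW t0p)//; lra.
have e'tq : e' * (t0 * q) <= t0 * q / 2 by rewrite mulrC ler_wpM2l//; lra.
have et0 : 0 <= e' * t0 by nneg.
have etq : 0 <= e' * (t0 * q) by rewrite mulr_ge0// ltW.
(* Affine minorant and majorant of the normalised squared residual at the two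
   end points of the scale interval, in terms of the squared noise. *)
pose k1 := (1 + e') * (1 - t0); pose rho1 := 1 + (1 + e') * t0 * q.
pose k2 := (1 - e') * (1 + t0); pose rho2 := 1 - 2 * (1 - e') * t0 * q.
have hF3l : cond_prob_le P (sigma_family x) (F3 k1 rho1 (-1)) eps.
  apply: hF3; rewrite ?normrN1// /k1 /rho1.
  - by apply/andP; split; lra.
  - by rewrite ger0_norm; lra.
  - lra.
have hF3u : cond_prob_le P (sigma_family x) (F3 k2 rho2 1) eps.
  apply: hF3; rewrite ?normr1// /k2 /rho2.
  - by apply/andP; split; lra.
  - by rewrite ger0_norm; lra.
  - lra.
exists (F1 1 `|` F1 (-1) `|` F2 `|` F3 k1 rho1 (-1) `|` F3 k2 rho2 1); split.
  apply: (@cond_prob_leW _ _ _ _ _ _ (eps + eps + eps + eps + eps)); first by lra.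
  do 4 (apply: cond_prob_leU => //).
  - by apply: hF1; rewrite normr1.
  - by apply: hF1; rewrite normrN1.
move=> w /not_orP[/not_orP[/not_orP[/not_orP[nF1 nF1'] nF2] nF3] nF3'] hx.
have hL := design_norm2_le hx.
have hG := design_gram_form_ge d0 hx.
apply: (@ridge_system_solution _ _ _ _ (fun i => y i w) (fun i => noise i w)
  thetastar psi1 psi2 a1 a2 lam0 sigma c_l L t0 e') => //.
- exact: (theta0_rate d0 n0 heps sigma0 cl0 lam00 L0 (erefl t0)).
- move=> j.
  have xE i : x i w j 0 = L * u 1 j (x i w).
    rewrite /u mul1r clip_id.
      by rewrite mulrCA divff ?mulr1// gt_eqF.
    rewrite normrM (gtr0_norm (_ : 0 < L^-1)) ?invr_gt0// ler_pdivrMr// mul1r.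
    apply: le_trans (hL i); rewrite -(@ler_pXn2r _ 2)// ?nnegrE ?norm2_ge0//.
    rewrite norm2_sqr real_normK ?num_real// /dotp (bigD1 j)//= -expr2 lerDl.
    by apply: sumr_ge0 => k _; rewrite -expr2 sqr_ge0.
  have -> : \sum_(i < n) x i w j 0 * psi1 (a1 * (noise i w / sigma)) =
      L * \sum_(i < n) u 1 j (x i w) * psi1 (a1 * (noise i w / sigma)).
    by rewrite mulr_sumr; apply: eq_bigr => i _; rewrite xE -mulrA.
  rewrite normrM (gtr0_norm L0) mulrCA ler_pM2l// ler_norml; apply/andP; split.
    rewrite lerNl leNgt; apply/negP => h; apply: nF1'; exists j.
    apply: (lt_le_trans h); rewrite -sumrN le_eqVlt; apply/orP; left; apply/eqP.
    by apply: eq_bigr => i _; rewrite /u; ring.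
  by rewrite leNgt; apply/negP => h; apply: nF1; exists j.
- by rewrite leNgt; apply/negP.
- rewrite leNgt; apply/negP => h; apply: nF3; rewrite /F3 /=.
  under eq_bigr do rewrite mulN1r.
  by rewrite sumrN oppr_gt0.
- rewrite leNgt; apply/negP => h; apply: nF3'; rewrite /F3 /=.
  by under eq_bigr do rewrite mul1r.
Qed.
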